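(* Let $s\in\mathbb{C}$ be a given transmitted symbol. In the non-synchronous (NS) operation, the joint probability density of the received vectors $(\boldsymbol{x},\boldsymbol{y})\in\mathbb{C}^M\times\mathbb{C}^M$ given $s$ is $$p(\boldsymbol{x},\boldsymbol{y}|s)=A\prod_{m=1}^{M}\left(\beta_{m,0}+2\sum_{l=1}^{\infty}\beta_{m,l}\cos(l\zeta_m)\right),\qquad \zeta_m=\arg(y_m)-\arg(x_m)-\arg(s),$$ where: (i) in the constant channel case (CC-NS), $$A=\frac{\exp\left(-\|\boldsymbol{x}\|^2-\|\boldsymbol{y}\|^2-\rho(1+|s|^2)\|\boldsymbol{g}\|^2\right)}{\pi^{2M}},\qquad \beta_{m,l}=\alpha_{m,l}\,I_l\left(2\sqrt{\rho}\,g_m|s^*y_m|\right)I_l\left(2\sqrt{\rho}\,g_m|x_m|\right);$$ (ii) in the fading channel case (FC-NS), $$A=\frac{\exp\left(-\frac{1+\rho|s|^2}{\rho+\rho|s|^2+1}\|\boldsymbol{x}\|^2-\frac{1+\rho}{\rho+\rho|s|^2+1}\|\boldsymbol{y}\|^2\right)}{\left(\pi^2(\rho+\rho|s|^2+1)\right)^M},\qquad \beta_{m,l}=\alpha_{m,l}\,I_l\left(\frac{2\rho|s^*x_m^*y_m|}{\rho+\rho|s|^2+1}\right).$$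
   Context: Notation: $M\ge 1$ is the number of receive antennas, $\rho>0$ the SNR, $(\cdot)^*$ complex conjugation, $\|\cdot\|$ the Euclidean norm, $I_l$ the modified Bessel function of the first kind of order $l$, $j$ the imaginary unit; $\mathcal{CN}(\boldsymbol{0},\boldsymbol{I}_M)$ is the circularly symmetric complex Gaussian law with density $\pi^{-M}e^{-\|\cdot\|^2}$ on $\mathbb{C}^M$. The value of $\arg(0)$ is an arbitrary convention (it does not matter since $I_l(0)=0$ for $l\ge1$). Phase noise increments: $\phi_m\in[-\pi,\pi)$ has pdf given by its Fourier expansion $p_{\Phi_m}(\phi_m)=\frac{1}{2\pi}\left(\alpha_{m,0}+2\sum_{l=1}^\infty\alpha_{m,l}\cos(l\phi_m)\right)$ with known real constants $\alpha_{m,l}$ (this form represents pdfs on $[-\pi,\pi)$, viewed as $2\pi$-periodic functions, that are continuous, differentiable, unimodal, even and zero mean). Constant channel, non-synchronous (CC-NS) model: $x_m=\sqrt{\rho}\,g_me^{j\theta_m}+w_m$, $y_m=\sqrt{\rho}\,g_me^{j(\theta_m+\phi_m)}s+z_m$ for $m=1,\dots,M$, where $\boldsymbol{g}=[g_1,\dots,g_M]^T$ with $g_m>0$ known constants, $\theta_1,\dots,\theta_M$ are uniform on $[-\pi,\pi)$, and $\boldsymbol{w},\boldsymbol{z}\sim\mathcal{CN}(\boldsymbol{0},\boldsymbol{I}_M)$. The variables $\theta_1,\dots,\theta_M,\phi_1,\dots,\phi_M,\boldsymbol{w},\boldsymbol{z}$ are mutually independent and independent of the symbol $s$. Fading channel,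 non-synchronous (FC-NS) model: $x_m=\sqrt{\rho}\,h_m+w_m$, $y_m=\sqrt{\rho}\,e^{j\phi_m}h_ms+z_m$ for $m=1,\dots,M$, where $\boldsymbol{h}=[h_1,\dots,h_M]^T\sim\mathcal{CN}(\boldsymbol{0},\boldsymbol{I}_M)$, $\boldsymbol{w},\boldsymbol{z}\sim\mathcal{CN}(\boldsymbol{0},\boldsymbol{I}_M)$, and $\phi_1,\dots,\phi_M,\boldsymbol{h},\boldsymbol{w},\boldsymbol{z}$ are mutually independent and independent of $s$. *)

(* Defs.v *)
From HB Require Import structures.
From mathcomp Require Import all_boot all_order all_algebra.
From mathcomp Require Import all_classical all_reals all_analysis.
From mathcomp.real_closed Require Import complex.
Set Implicit Arguments.
Unset Strict Implicit.
Unset Printing Implicit Defensive.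
Import Order.TTheory GRing.Theory Num.Theory.
Import numFieldNormedType.Exports.
Local Open Scope classical_set_scope.
Local Open Scope ring_scope.
Local Open Scope complex_scope.

Definition reim (R : realType) (z : R[i]) :
    measurableTypeR R * measurableTypeR R :=
  (complex.Re z, complex.Im z).
Definition ofreim (R : realType)
    (p : measurableTypeR R * measurableTypeR R) : R[i] :=
  p.1 +i* p.2.

HB.instance Definition _ (R : realType) := isPointed.Build R[i] 0.

(* Borel sigma-algebra of C, through the identification of C with R * R. *)
HB.instance Definition _ (R : realType) :=
  Measurable.copy R[i] (g_sigma_algebra_preimageType (@reim R)).

Lemma measurable_reim (R : realType) : measurable_fun setT (@reim R).
Proof. by move=> _ A mA; exists A. Qed.

Lemma measurable_ofreim (R : realType) : measurable_fun setT (@ofreim R).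
Proof.
move=> _ _ [A mA <-]; rewrite !setTI.
by have -> : @ofreim R @^-1` (@reim R @^-1` A) = A by apply/seteqP; split=> -[].
Qed.

Lemma sigma_finite_product d1 d2 (T1 : measurableType d1)
    (T2 : measurableType d2) (R : realType)
    (m1 : {sigma_finite_measure set T1 -> \bar R})
    (m2 : {sigma_finite_measure set T2 -> \bar R}) :
  sigma_finite setT (m1 \x m2)%E.
Proof.
have /sigma_finiteP[F [TF ndF Foo]] := sigma_finiteT m1.
have /sigma_finiteP[G [TG ndG Goo]] := sigma_finiteT m2.
exists (fun n => F n `*` G n).
  rewrite -setXTT TF TG predeqE => -[x y]; split.
    move=> [/= [n _ Fnx] [k _ Gky]]; exists (maxn n k) => //; split.
    - by move: x Fnx; exact/subsetPset/ndF/leq_maxl.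
    - by move: y Gky; exact/subsetPset/ndG/leq_maxr.
  by move=> [n _ []/= ? ?]; split; exists n.
move=> k; have [mF Fk] := Foo k; have [mG Gk] := Goo k.
split; first exact: measurableX.
by rewrite product_measure1E// lte_mul_pinfty// ge0_fin_numE.
Qed.

Lemma sigma_finite_pushforward d1 d2 (T1 : measurableType d1)
    (T2 : measurableType d2) (R : realType)
    (mu : set T1 -> \bar R) (f : T1 -> T2) (g : T2 -> T1) :
  sigma_finite setT mu -> measurable_fun setT g -> cancel f g -> cancel g f ->
  sigma_finite setT (pushforward mu f).
Proof.
move=> [F UF mF] mg fK gK.
exists (fun k => g @^-1` F k).
  by rewrite -preimage_bigcup -UF preimage_setT.
move=> k; have [mFk Fkoo] := mF k; split.
  by rewrite -[X in measurable X]setTI; exact: mg.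
by rewrite /pushforward -comp_preimage (_ : g \o f = id)//; apply/funext.
Qed.

Section sigma_finite_measure_of.
Context d (T : measurableType d) (R : realType).
Variable m : {measure set T -> \bar R}.
Hypothesis sm : sigma_finite setT m.

Definition sigma_finite_measure_of & sigma_finite setT m : set T -> \bar R := m.

Local Notation sfm := (sigma_finite_measure_of sm).
HB.instance Definition _ := Measure.copy sfm m.
HB.instance Definition _ := Measure_isSigmaFinite.Build _ _ _ sfm sm.

End sigma_finite_measure_of.

Section lebesgue_complex.
Variable R : realType.

Definition lebesgue_complex : set R[i] -> \bar R :=
  pushforward (@lebesgue_measure R \x @lebesgue_measure R)%E (@ofreim R).

Let lebC0 : lebesgue_complex set0 = 0%E.
Proof. by rewrite /lebesgue_complex /pushforward preimage_set0 measure0. Qed.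

Let lebC_ge0 A : (0 <= lebesgue_complex A)%E.
Proof. by rewrite /lebesgue_complex /pushforward; exact: measure_ge0. Qed.

Let lebC_sigma_additive : semi_sigma_additive lebesgue_complex.
Proof.
exact: (@measure_semi_sigma_additive _ _ _
  (measure_function_pushforward__canonical__measure_function_Measure
    (@lebesgue_measure R \x @lebesgue_measure R)%E (@measurable_ofreim R))).
Qed.

HB.instance Definition _ := isMeasure.Build _ _ _ lebesgue_complex
  lebC0 lebC_ge0 lebC_sigma_additive.

Let lebC_sigma_finite : sigma_finite setT lebesgue_complex.
Proof.
have sm := sigma_finite_product (@lebesgue_measure R) (@lebesgue_measure R).
by apply: (sigma_finite_pushforward sm (@measurable_reim R)) => -[].
Qed.

HB.instance Definition _ := Measure_isSigmaFinite.Build _ _ _ lebesgue_complex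
  lebC_sigma_finite.

End lebesgue_complex.

Section tuple_measure.
Context d (T : measurableType d) (R : realType).

Definition tuple_cons n (p : T * n.-tuple T) : n.+1.-tuple T :=
  [tuple of p.1 :: p.2].
Definition tuple_uncons n (t : n.+1.-tuple T) : T * n.-tuple T :=
  (thead t, [tuple of behead t]).

Lemma measurable_tuple_cons n : measurable_fun setT (@tuple_cons n).
Proof.
by apply: measurable_cons; [exact: measurable_fst|exact: measurable_snd].
Qed.

Lemma measurable_tuple_uncons n : measurable_fun setT (@tuple_uncons n).
Proof.
apply: measurable_fun_pair; last exact: measurable_behead.
exact: (measurable_tnth ord0).
Qed.

(* The n-fold product of mu, through T * n.-tuple T = n.+1.-tuple T; the
   instances below need mu to be sigma-finite. *)
Fixpoint tuple_measure (mu : set T -> \bar R) n : set (n.-tuple T) -> \bar R :=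
  if n is n'.+1 then pushforward (mu \x @tuple_measure mu n')%E (@tuple_cons n')
  else \d_[tuple].
Arguments tuple_measure : clear implicits.

Variable mu : {sigma_finite_measure set T -> \bar R}.

Lemma tuple_measure_sigma_finite n :
  exists nu : {sigma_finite_measure set (n.-tuple T) -> \bar R},
    nu = tuple_measure mu n :> (set (n.-tuple T) -> \bar R).
Proof.
elim: n => [|n [nu nuE]] /=; first by exists (\d_[tuple]).
pose m := measure_function_pushforward__canonical__measure_function_Measure
  (mu \x nu)%E (@measurable_tuple_cons n).
have sm : sigma_finite setT m.
  apply: (sigma_finite_pushforward (sigma_finite_product mu nu)
    (@measurable_tuple_uncons n)).
  - move=> [x t]; congr pair; apply/val_inj => //=.
  - by move=> t; apply/val_inj; rewrite /= [in RHS](tuple_eta t).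
by exists (sigma_finite_measure_of sm); rewrite /= -nuE.
Qed.

Section instances.
Variable n : nat.
Local Notation mun := (tuple_measure mu n).

Let mun0 : mun set0 = 0%E.
Proof. by have [nu <-] := tuple_measure_sigma_finite n; rewrite measure0. Qed.

Let mun_ge0 A : (0 <= mun A)%E.
Proof.
by have [nu <-] := tuple_measure_sigma_finite n; exact: measure_ge0.
Qed.

Let mun_sigma_additive : semi_sigma_additive mun.
Proof.
have [nu <-] := tuple_measure_sigma_finite n.
exact: measure_semi_sigma_additive.
Qed.

HB.instance Definition _ := isMeasure.Build _ _ _ mun
  mun0 mun_ge0 mun_sigma_additive.

Let mun_sigma_finite : sigma_finite setT mun.
Proof.
by have [nu <-] := tuple_measure_sigma_finite n; exact: sigma_finiteT.
Qed.

HB.instance Definition _ := Measure_isSigmaFinite.Build _ _ _ mun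
  mun_sigma_finite.

End instances.

End tuple_measure.
Arguments tuple_measure {d T R} mu n.

Definition lebesgue_cvec (R : realType) (M : nat) :
    {sigma_finite_measure set (M.-tuple R[i]) -> \bar R} :=
  tuple_measure (@lebesgue_complex R) M.

Section complex_functions.
Variable R : realType.
Implicit Types (z : R[i]) (t : R).

Definition cexpi t : R[i] := cos t +i* sin t.

Definition cmod z : R := complex.ComplexField.Normc.normc z.

(* Principal argument, in ]-pi, pi]; since 0 / 0 = 0, carg 0 = pi / 2. *)
Definition carg z : R :=
  if 0 <= complex.Im z then acos (complex.Re z / cmod z)
  else - acos (complex.Re z / cmod z).

Definition norm2 M (v : M.-tuple R[i]) : R := \sum_(m < M) cmod (tnth v m) ^+ 2.

Definition besselI (l : nat) (x : R) : R :=
  limn (series (fun k => (x / 2) ^+ (2 * k + l) / (k`! * (k + l)`!)%:R)).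

Definition cos_psum (c : nat -> R) t : R^nat :=
  fun n => \sum_(1 <= l < n.+1) c l * cos (l%:R * t).

Definition cos_series (c : nat -> R) t : R := c 0%N + 2 * limn (cos_psum c t).

End complex_functions.

Section probability.
Context d (T : measurableType d) (R : realType) (P : probability T R).

Definition has_density d' (U : measurableType d')
    (mu : {measure set U -> \bar R}) (X : T -> U) (f : U -> R) : Prop :=
  [/\ measurable_fun setT X, measurable_fun setT f, (forall u, 0 <= f u) &
    forall B, measurable B -> P (X @^-1` B) = (\int[mu]_(u in B) (f u)%:E)%E].

(* Disintegration of the joint law of (S, X): f s is the density of X given
   S = s. The law of S is arbitrary (possibly discrete or constant). *)
Definition has_conditional_density d' (U : measurableType d')
    d'' (V : measurableType d'') (mu : {measure set U -> \bar R})
    (S : {RV P >-> V}) (X : T -> U) (f : V -> U -> R) : Prop :=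
  [/\ measurable_fun setT X,
    measurable_fun setT (fun su : V * U => f su.1 su.2),
    (forall s u, 0 <= f s u) &
    forall A B, measurable A -> measurable B ->
      P (S @^-1` A `&` X @^-1` B) =
      (\int[distribution P S]_(s in A) \int[mu]_(u in B) (f s u)%:E)%E].

Definition sigma_generated d' (U : measurableType d') (X : T -> U) :
    set (set T) :=
  preimage_set_system setT X measurable.

Definition mutually_independent (I : finType) (F : I -> set (set T)) : Prop :=
  forall (J : {set I}) (E : I -> set T),
    (forall i, i \in J -> F i (E i)) ->
    P (\bigcap_(i in [set` J]) E i) = (\prod_(i in J) P (E i))%E.

Definition uniform_phase (theta : {RV P >-> R}) : Prop :=
  has_density lebesgue_measure theta (uniform_pdf (- pi) pi).

Definition gaussian_pdf M (v : M.-tuple R[i]) : R :=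
  pi ^- M * expR (- norm2 v).

Definition standard_gaussian M (w : {RV P >-> M.-tuple R[i]}) : Prop :=
  has_density (lebesgue_cvec R M) w (@gaussian_pdf M).

Definition phase_noise_pdf (alpha : nat -> R) (t : R) : R :=
  if - pi <= t < pi then (2 * pi)^-1 * cos_series alpha t else 0.

(* The pdf is the pointwise sum of its own Fourier series: the alpha l are its
   cosine coefficients (hence alpha 0 = 1). Evenness follows from the form of the
   series, and no regularity beyond the convergence of the series is required. *)
Record phase_noise (alpha : nat -> R) (phi : {RV P >-> R}) : Prop := {
  phase_noise_cvg : forall t, - pi <= t < pi -> cvgn (cos_psum alpha t);
  phase_noise_coef : forall l, alpha l =
    \int[lebesgue_measure]_(t in `[- pi, pi[)
      (phase_noise_pdf alpha t * cos (l%:R * t));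
  phase_noise_density :
    has_density lebesgue_measure phi (phase_noise_pdf alpha) }.

End probability.

Section models.
Context d (T : measurableType d) (R : realType) (P : probability T R).
Variables (M : nat) (rho : R) (alpha : 'I_M -> nat -> R).

Section constant_channel.
Variables (g : 'I_M -> R) (theta phi : 'I_M -> {RV P >-> R}).
Variables (w z : {RV P >-> M.-tuple R[i]}).

(* S is a function on the sample space, so that the same definition covers a
   fixed symbol (a constant function) and a random one. *)
Definition cc_ns_output (S : T -> R[i]) (t : T) :
    M.-tuple R[i] * M.-tuple R[i] :=
  ([tuple (Num.sqrt rho * g m)%:C * cexpi (theta m t) + tnth (w t) m | m < M],
   [tuple (Num.sqrt rho * g m)%:C * cexpi (theta m t + phi m t) * S t
          + tnth (z t) m | m < M]).

Record cc_ns_model (S : {RV P >-> R[i]}) : Prop := {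
  cc_gain : forall m, 0 < g m;
  cc_theta : forall m, uniform_phase (theta m);
  cc_phi : forall m, phase_noise (alpha m) (phi m);
  cc_w : standard_gaussian w;
  cc_z : standard_gaussian z;
  cc_indep : mutually_independent P
    (fun i : 'I_M + 'I_M + 'I_3 => match i with
      | inl (inl m) => sigma_generated (theta m)
      | inl (inr m) => sigma_generated (phi m)
      | inr k => tnth [tuple sigma_generated w; sigma_generated z;
                             sigma_generated S] k
      end) }.

End constant_channel.

Section fading_channel.
Variables (phi : 'I_M -> {RV P >-> R}) (h w z : {RV P >-> M.-tuple R[i]}).

Definition fc_ns_output (S : T -> R[i]) (t : T) :
    M.-tuple R[i] * M.-tuple R[i] :=
  ([tuple (Num.sqrt rho)%:C * tnth (h t) m + tnth (w t) m | m < M],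
   [tuple (Num.sqrt rho)%:C * cexpi (phi m t) * tnth (h t) m * S t
          + tnth (z t) m | m < M]).

Record fc_ns_model (S : {RV P >-> R[i]}) : Prop := {
  fc_phi : forall m, phase_noise (alpha m) (phi m);
  fc_h : standard_gaussian h;
  fc_w : standard_gaussian w;
  fc_z : standard_gaussian z;
  fc_indep : mutually_independent P
    (fun i : 'I_M + 'I_4 => match i with
      | inl m => sigma_generated (phi m)
      | inr k => tnth [tuple sigma_generated h; sigma_generated w;
                             sigma_generated z; sigma_generated S] k
      end) }.

End fading_channel.
End models.

Section densities.
Variables (R : realType) (M : nat) (rho : R) (alpha : 'I_M -> nat -> R).
Implicit Types (s : R[i]) (x y : M.-tuple R[i]).

Definition zeta s x y (m : 'I_M) : R :=
  carg (tnth y m) - carg (tnth x m) - carg s.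

Section constant_channel.
Variable g : 'I_M -> R.

Definition cc_ns_A s x y : R :=
  expR (- norm2 x - norm2 y
        - rho * (1 + cmod s ^+ 2) * \sum_(m < M) g m ^+ 2) / pi ^+ (2 * M).

Definition cc_ns_beta s x y (m : 'I_M) (l : nat) : R :=
  alpha m l * besselI l (2 * Num.sqrt rho * g m * cmod (s^* * tnth y m))
            * besselI l (2 * Num.sqrt rho * g m * cmod (tnth x m)).

End constant_channel.

Definition fc_ns_A s x y : R :=
  let D := rho + rho * cmod s ^+ 2 + 1 in
  expR (- ((1 + rho * cmod s ^+ 2) / D) * norm2 x - (1 + rho) / D * norm2 y)
  / (pi ^+ 2 * D) ^+ M.

Definition fc_ns_beta s x y (m : 'I_M) (l : nat) : R :=
  let D := rho + rho * cmod s ^+ 2 + 1 in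
  alpha m l
  * besselI l (2 * rho * cmod (s^* * (tnth x m)^* * tnth y m) / D).

Definition ns_density (A : R[i] -> M.-tuple R[i] -> M.-tuple R[i] -> R)
    (beta : R[i] -> M.-tuple R[i] -> M.-tuple R[i] -> 'I_M -> nat -> R)
    s (xy : M.-tuple R[i] * M.-tuple R[i]) : R :=
  A s xy.1 xy.2 *
  \prod_(m < M) cos_series (beta s xy.1 xy.2 m) (zeta s xy.1 xy.2 m).

End densities.

(* Main.v *)
(** Given the hidden variables (theta, phi), resp. (h, phi), the received vector
    is a translate of the Gaussian noise (w, z), so its density is an expectation
    of a product of Gaussian densities, which factors over the antennas by
    independence.  For one antenna, the exponent is a sum of terms
    kappa * cos (angle): in the constant channel, expanding both exponentials by
    the Jacobi-Anger formula
      exp (kappa cos u) = I_0 kappa + 2 sum_(l >= 1) I_l kappa cos (l u)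
    and averaging over the uniform phase keeps only the products I_l I_l of equal
    order; in the fading channel, a Gaussian integral over h leaves a single
    exponential.  Averaging over phi then multiplies the l-th coefficient by
    E cos (l phi) = alpha_l, the sine coefficients vanishing since the pdf is
    even. *)
Require Import Defs.
From mathcomp Require Import all_boot all_order all_algebra.
From mathcomp Require Import all_classical all_reals all_analysis.
From mathcomp.real_closed Require Import complex.
From HB Require Import structures.
From mathcomp Require Import measurable_realfun ring lra zify.
Set Implicit Arguments.
Unset Strict Implicit.
Unset Printing Implicit Defensive.
Import Order.TTheory GRing.Theory Num.Theory.
Import numFieldNormedType.Exports.
Local Open Scope classical_set_scope.
Local Open Scope ring_scope.

(** * The Jacobi-Anger expansion *)

(** The Jacobi-Anger formula is proved over the reals: exp (x cos u) is expanded in powers of 2 cos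
    u, each power by the binomial theorem, and the double sum over (j, k) is then resummed along |j
    - k| instead of j + k. The alpha_l are not known to be absolutely summable, so domination always
    comes from the Bessel factors, together with |alpha_l| <= 1, alpha_l being the mean of a cosine.

    Both channels are instances of one model, x_m = a_m (X_m) + w_m and y_m = b_m (s, X_m, Y_m) +
    z_m, where X is theta or h and Y is phi; only the average over one antenna is specific to a
    channel.

    The main obstacle is that mutual independence gives product formulas for events about separate
    variables, whereas the argument needs the independence of grouped vectors such as (w, z) and (X,
    Y). Uniqueness of measures on pi-systems bridges the gap. A random symbol is independent of all
    the rest, so it can be frozen, and the density for a fixed symbol becomes the conditional
    one. *)

Section double_sums.
Variable R : realType.
Local Open Scope ereal_scope.
Implicit Types a : nat -> nat -> \bar R.

(** For nonnegative terms, the Cauchy-product order is a sum over all pairs, reindexed by (n, j) ->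
    (j, n - j). The unordered form can then be cut along other lines. *)
Lemma esum_antidiagonal a : (forall j k, 0 <= a j k) ->
  \sum_(n <oo) \sum_(j < n.+1) a j (n - j)%N =
  \esum_(i in [set: nat * nat]) a i.1 i.2.
Proof.
move=> a0; rewrite nneseries_esumT; last by move=> n; exact: sume_ge0.
transitivity (\esum_(n in [set: nat]) \esum_(j in `I_n.+1) a j (n - j)%N).
  apply: eq_esum => n _; rewrite esum_fset//.
    by rewrite -(fsbig_ord _ _ (fun j => a j (n - j)%N)).
rewrite esum_esum//.
rewrite [RHS](reindex_esum ([set: nat] `*`` (fun n => `I_n.+1)) _
  (fun i => (i.2, i.1 - i.2)%N))//; split=> //=.
  move=> [n1 j1] [n2 j2]; rewrite !inE/= => -[_ h1] [_ h2] [je e]; rewrite je.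
  by congr pair; lia.
by move=> [j k] _; exists (j + k, j)%N => /=; [split=> //=; lia|congr pair; lia].
Qed.

(** The pairs are split according to the sign of k - j and then sorted by l = |j - k|. The second
    sum starts at distance [l.+1], so that the main diagonal is counted once. *)
Lemma esum_diagonals a : (forall j k, 0 <= a j k) ->
  \esum_(i in [set: nat * nat]) a i.1 i.2 =
  \sum_(l <oo) \sum_(k <oo) a k (k + l)%N +
  \sum_(l <oo) \sum_(k <oo) a (k + l.+1)%N k.
Proof.
move=> a0; rewrite (esumID [set i | i.1 <= i.2]%N)// !setTI.
have E (b : nat -> nat -> \bar R) : (forall j k, 0 <= b j k) ->
    \sum_(l <oo) \sum_(k <oo) b l k = \esum_(i in [set: nat * nat]) b i.1 i.2.
  move=> b0; rewrite nneseries_esumT; last by move=> n; exact: nneseries_ge0.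
  under eq_esum do rewrite nneseries_esumT//.
  by rewrite esum_esum//; congr esum; apply/seteqP; split.
rewrite !E//; congr (_ + _).
- rewrite (reindex_esum [set: nat * nat] _ (fun i => (i.2, i.2 + i.1)%N))//.
  split=> //=; first by move=> [l k] _ /=; rewrite leq_addr.
    by move=> [l k] [l' k'] _ _ /= [e1 e2]; congr pair; lia.
  move=> [j k]/= jk; exists (k - j, j)%N => //=.
  by congr pair; lia.
- rewrite (reindex_esum [set: nat * nat] _ (fun i => (i.2 + i.1.+1, i.2)%N))//.
  split=> //=; first by move=> [l k] _ /=; apply/negP; lia.
    by move=> [l k] [l' k'] _ _ /= [e1 e2]; congr pair; lia.
  move=> [j k]/= /negP jk; exists (j - k.+1, k)%N => //=.
  by congr pair; lia.
Qed.

End double_sums.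

Lemma eseries_EFin (R : realType) (u : R^nat) :
  cvgn (series u) -> (\sum_(k <oo) (u k)%:E)%E = (limn (series u))%:E.
Proof.
move=> cu; rewrite -EFin_lim//; congr (limn _); apply/funext => n /=.
by rewrite sumEFin.
Qed.

Lemma cvg_seriesZ (R : realType) (u : R^nat) (c : R) :
  cvgn (series u) -> series (fun n => c * u n) @ \oo --> c * limn (series u).
Proof.
move=> cu; have -> : series (fun n => c * u n) = (fun n => c * series u n).
  by apply/funext => n; rewrite /series/= mulr_sumr.
exact: cvgMl_tmp.
Qed.

(** * Powers of a cosine as sums of cosines *)

Section complex_exponential.
Variable R : realType.
Implicit Types (a b : R) (n : nat).
Local Open Scope complex_scope.

Lemma cexpiD a b : cexpi (a + b) = cexpi a * cexpi b.
Proof. by rewrite /cexpi cosD sinD; simpc; rewrite [sin a * cos b + _]addrC. Qed.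

Lemma cexpiX n a : cexpi a ^+ n = cexpi (n%:R * a).
Proof.
elim: n => [|n IH]; first by rewrite expr0 mul0r /cexpi cos0 sin0.
by rewrite exprS IH -cexpiD -natr1 mulrDl mul1r addrC.
Qed.

Lemma cexpi_addN a : cexpi a + cexpi (- a) = (2 * cos a)%:C.
Proof. rewrite /cexpi cosN sinN; simpc. by rewrite mulrDl mul1r. Qed.

(** Subtraction on [nat] is truncated, so [(j - k) + (k - j)] is |j - k|; evenness of the cosine
    absorbs the lost sign. *)
Lemma cos_distn j k a :
  cos (((j - k) + (k - j))%:R * a) = cos (j%:R * a - k%:R * a).
Proof.
case: (leqP j k) => jk.
  by rewrite (eqP jk) add0n natrB// -cosN mulrBl opprB.
by rewrite (eqP (ltnW jk)) addn0 natrB ?(ltnW jk)// mulrBl.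
Qed.

(** Real part of the binomial expansion of the n-th power of exp (ia) + exp (-ia). The term j has
    frequency j - (n - j), written as an absolute difference to match the diagonals of the double
    sum. *)
Lemma cos_exprn n a : (2 * cos a) ^+ n =
  \sum_(j < n.+1) ('C(n, j))%:R * cos (((j - (n - j)) + ((n - j) - j))%:R * a).
Proof.
have : ((2 * cos a) ^+ n)%:C = (cexpi a + cexpi (- a)) ^+ n.
  by rewrite cexpi_addN rmorphXn.
rewrite (addrC (cexpi a)) exprDn => /(congr1 (@complex.Re R)) /= ->.
rewrite raddf_sum; apply: eq_bigr => j _.
rewrite !cexpiX -cexpiD raddfMn [RHS]mulr_natl cos_distn; congr (_ *+ _).
by rewrite /cexpi/= mulrN addrC.
Qed.

End complex_exponential.

Section jacobi_anger.
Variable R : realType.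
Implicit Types (x u : R) (l : nat).

Definition besselI_term l x (k : nat) : R :=
  (x / 2) ^+ (2 * k + l) / (k`! * (k + l)`!)%:R.

Lemma besselI_term_ge0 l x k : 0 <= x -> 0 <= besselI_term l x k.
Proof. by move=> x0; rewrite divr_ge0// exprn_ge0// divr_ge0. Qed.

(** Dropping the factor (k + l)! >= 1 leaves (x / 2)^l times the exponential series at (x / 2)^2. *)
Lemma cvg_besselI_term l x : 0 <= x -> cvgn (series (besselI_term l x)).
Proof.
move=> x0; have r0 : 0 <= x / 2 by rewrite divr_ge0.
apply: (@series_le_cvg _ _ (fun k => (x / 2) ^+ l * exp_coeff ((x / 2) ^+ 2) k)).
- by move=> k; exact: besselI_term_ge0.
- by move=> k; rewrite mulr_ge0 ?exprn_ge0// exp_coeff_ge0// exprn_ge0.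
- move=> k; rewrite /besselI_term /exp_coeff/= exprD exprM.
  rewrite [X in X / _]mulrC -mulrA ler_wpM2l ?exprn_ge0// ler_wpM2l ?exprn_ge0//.
  rewrite lef_pV2 ?posrE ?ltr0n ?muln_gt0 ?fact_gt0// ler_nat.
  by rewrite leq_pmulr// fact_gt0.
- by apply/cvg_ex; eexists; apply: cvg_seriesZ; exact: is_cvg_series_exp_coeff.
Qed.

Lemma besselI_ge0 l x : 0 <= x -> 0 <= besselI l x.
Proof.
move=> x0; apply: limr_ge; first exact: cvg_besselI_term.
by apply: nearW => n; apply: sumr_ge0 => k _; exact: besselI_term_ge0.
Qed.

(* Nonnegative weights F make every rearrangement of the double series legal.
   They are taken of the form F l = 1 + e cos (l u): e = 0 gives summability
   and e = 1, by difference, the expansion. *)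
Let weight x (F : nat -> R) j k : \bar R :=
  ((x / 2) ^+ (j + k) / (j`! * k`!)%:R * F ((j - k) + (k - j))%N)%:E.

(** The left side sums by total degree j + k, the right side by distance |j - k|, on which alone [F]
    depends. Along each diagonal at distance l the remaining sum is the series of I_l; the two sums
    stand for the two signs of j - k. *)
Let jacobi_anger_weighted x (F : nat -> R) : 0 <= x -> (forall l, 0 <= F l) ->
  (\sum_(n <oo) \sum_(j < n.+1) weight x F j (n - j)%N)%E =
  (\sum_(l <oo) (besselI l x * F l)%:E +
   \sum_(l <oo) (besselI l.+1 x * F l.+1)%:E)%E.
Proof.
move=> x0 F0; have w0 j k : (0 <= weight x F j k)%E.
  by rewrite lee_fin mulr_ge0// divr_ge0// exprn_ge0// divr_ge0.
rewrite esum_antidiagonal// esum_diagonals//.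
have E l : (\sum_(k <oo) (besselI_term l x k * F l)%:E)%E =
    (besselI l x * F l)%:E.
  under eq_eseriesr do rewrite mulrC.
  have h := cvg_seriesZ (c := F l) (cvg_besselI_term (l := l) x0).
  rewrite eseries_EFin; last exact: cvgP h.
  by rewrite (cvg_lim _ h)// mulrC.
congr (_ + _)%E; apply: eq_eseriesr => l _; rewrite -E; apply: eq_eseriesr => k _.
- rewrite /weight /besselI_term; congr (_ / _ * F _)%:E.
  + by congr (_ ^+ _); lia.
  + lia.
- rewrite /weight /besselI_term; congr (_ / _%:R * F _)%:E.
  + by congr (_ ^+ _); lia.
  + by rewrite mulnC.
  + lia.
Qed.

(** On an antidiagonal the weight 1 adds up to 2^n and the cosine to (2 cos u)^n. The factor 2^n
    cancels the one in (x / 2)^n and leaves two exponential terms. *)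
Let binomial_weight (x e u : R) n : (\sum_(j < n.+1)
    weight x (fun l => (1 + e * cos (l%:R * u))%R) j (n - j)%N)%E =
  (exp_coeff x n + e * exp_coeff (x * cos u) n)%:E.
Proof.
rewrite sumEFin; congr EFin.
have two_n : \sum_(j < n.+1) ('C(n, j))%:R = 2 ^+ n :> R.
  have := cos_exprn n (0 : R); rewrite cos0 mulr1 => ->.
  by apply: eq_bigr => j _; rewrite mulr0 cos0 mulr1.
transitivity (\sum_(j < n.+1) (x / 2) ^+ n / n`!%:R * (('C(n, j))%:R + e *
    (('C(n, j))%:R * cos (((j - (n - j)) + ((n - j) - j))%:R * u)))).
  apply: eq_bigr => j _; have jn : (j <= n)%N by rewrite -ltnS.
  rewrite subnKC// -(bin_fact jn) !natrM.
  by field; rewrite !pnatr_eq0 -!lt0n !fact_gt0 bin_gt0 jn.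
rewrite -mulr_sumr big_split/= -mulr_sumr -cos_exprn two_n.
rewrite /exp_coeff/= !exprMn exprVn; field.
by rewrite !pnatr_eq0 -!lt0n !fact_gt0 expf_neq0.
Qed.

Let jacobi_anger_ge0 (x e u : R) : 0 <= x -> 0 <= e <= 1 ->
  (expR x + e * expR (x * cos u))%:E =
  (\sum_(l <oo) (besselI l x * (1 + e * cos (l%:R * u)))%R%:E +
   \sum_(l <oo) (besselI l.+1 x * (1 + e * cos (l.+1%:R * u)))%R%:E)%E.
Proof.
move=> x0 /andP[e0 e1].
rewrite -(@jacobi_anger_weighted _ (fun l => 1 + e * cos (l%:R * u)))//.
  under eq_eseriesr do rewrite binomial_weight.
  have h1 := is_cvg_series_exp_coeff x.
  have h2 := cvg_seriesZ (c := e) (is_cvg_series_exp_coeff (x * cos u)).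
  have h : series (fun n => exp_coeff x n + e * exp_coeff (x * cos u) n) @ \oo
      --> expR x + e * expR (x * cos u).
    rewrite (_ : series _ = series (exp_coeff x) \+
      series (fun n => e * exp_coeff (x * cos u) n)); first exact: cvgD.
    by apply/funext => n; rewrite /series/= big_split.
  by rewrite eseries_EFin ?(cvg_lim _ h)//; exact: cvgP h.
move=> l; have := cos_geN1 (l%:R * u); have := e1; nra.
Qed.

(** The weighted identity at e = 0 bounds this nonnegative series by [expR x]. *)
Lemma cvg_series_besselI x : 0 <= x -> cvgn (series (fun l => besselI l x)).
Proof.
move=> x0; have := @jacobi_anger_ge0 x 0 0 x0; rewrite lexx ler01 mul0r addr0.
move=> /(_ isT); under eq_eseriesr do rewrite mul0r addr0 mulr1.
move=> h; apply: nnseries_is_cvg => [l|]; first exact: besselI_ge0.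
apply: (@le_lt_trans _ _ (expR x)%:E); last exact: ltry.
by rewrite h leeDl// nneseries_ge0// => l _ _; rewrite lee_fin mulr_ge0 ?besselI_ge0//
  mul0r addr0.
Qed.

Lemma cos_psumS (c : nat -> R) u :
  cos_psum c u = series (fun l => c l.+1 * cos (l.+1%:R * u)).
Proof. by apply/funext => n; rewrite /cos_psum big_add1. Qed.

Lemma cvg_seriesS (a : R^nat) : cvgn (series a) ->
  cvgn (series (fun l => a l.+1)) /\
  limn (series a) = a 0%N + limn (series (fun l => a l.+1)).
Proof.
move=> ca; have h : series (fun l => a l.+1) @ \oo --> limn (series a) - a 0%N.
  have -> : series (fun l => a l.+1) = (fun n => series a n.+1 - a 0%N).
    by apply/funext => n; rewrite /series/= big_nat_recl// addrC addKr.
  by apply: cvgB; [rewrite (cvg_shiftS (series a))|exact: cvg_cst].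
by split; [exact: cvgP h|rewrite (cvg_lim _ h)// addrC subrK].
Qed.

Lemma cvg_series_cos (a : R^nat) u : cvgn (series (fun l => `|a l|)) ->
  cvgn (series (fun l => a l * cos (l%:R * u))).
Proof.
move=> ca; apply: (@normed_cvg _ R^o).
have : cvgn (series (fun l => `|a l * cos (l%:R * u)|)).
  apply: series_le_cvg ca => // l; rewrite normrM ler_piMr//; exact: cos_max.
by [].
Qed.

Lemma cvg_cos_psum (a : R^nat) u : cvgn (series (fun l => `|a l|)) ->
  cvgn (cos_psum a u).
Proof.
move=> ca; rewrite cos_psumS.
by have [] := cvg_seriesS (@cvg_series_cos _ u ca).
Qed.

(** The weighted identity at e = 1 minus the one at e = 0. Both are transferred to real limits
    first, which the absolute convergence allows; the two half-sums share all orders l >= 1, hence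
    the factor 2. *)
Lemma jacobi_anger x u : 0 <= x ->
  expR (x * cos u) = cos_series (fun l => besselI l x) u.
Proof.
move=> x0; have cI := cvg_series_besselI x0.
have cIn : cvgn (series (fun l => `|besselI l x|)).
  by under eq_fun do rewrite ger0_norm ?besselI_ge0//.
have cC := @cvg_series_cos _ u cIn.
have [cI' eI] := cvg_seriesS cI; have [cC' eC] := cvg_seriesS cC.
have h0 := @jacobi_anger_ge0 x 0 u x0; rewrite lexx ler01 in h0.
move: (h0 isT) => {h0}; rewrite mul0r addr0.
under eq_eseriesr do rewrite mul0r addr0 mulr1.
under [X in (_ = _ + X)%E -> _]eq_eseriesr do rewrite mul0r addr0 mulr1.
rewrite !eseries_EFin// => -[Ex].
have := @jacobi_anger_ge0 x 1 u x0; rewrite lexx ler01 mul1r => /(_ isT).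
under eq_eseriesr do rewrite mul1r mulrDr mulr1.
under [X in (_ = _ + X)%E -> _]eq_eseriesr do rewrite mul1r mulrDr mulr1.
have E (a b : R^nat) : series (fun n => a n + b n) = series a \+ series b.
  by apply/funext => n; rewrite /series/= big_split.
rewrite !eseries_EFin; [|by rewrite E; exact: is_cvgD..].
rewrite !E !limD// => -[]; rewrite Ex eC eI mul0r cos0 mulr1.
by rewrite /cos_series cos_psumS => h; lra.
Qed.

End jacobi_anger.

(** * Averages over the random phases *)

Section bounded_measurable.
Context d (T : measurableType d) (R : realType) (P : probability T R).
Implicit Types (f g h : T -> R) (a : R^nat).

(** On a probability space this implies integrability and is stable under sums and products, so it
    serves as the uniform side condition for expectations. *)
Definition bounded_measurable f :=
  measurable_fun setT f /\ exists K : R, forall t, `|f t| <= K.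

Lemma bounded_measurable_integrable f :
  bounded_measurable f -> P.-integrable setT (EFin \o f).
Proof.
move=> [mf [K fK]]; apply: measurable_bounded_integrable => //.
  by rewrite (@le_lt_trans _ _ 1%E)//= ?ltry// probability_le1.
exists K; split; first exact: num_real.
by move=> M KM t _; exact: le_trans (fK t) (ltW KM).
Qed.

Lemma bounded_measurable_cst c : bounded_measurable (fun=> c).
Proof. by split => //; exists `|c|. Qed.

Lemma bounded_measurable_cos h l : measurable_fun setT h ->
  bounded_measurable (fun t => cos (l%:R * h t)).
Proof.
move=> mh; split; last by exists 1 => t; exact: cos_max.
apply: (measurableT_comp (f := cos)).
  by apply: continuous_measurable_fun; exact: continuous_cos.
exact: measurable_funM.
Qed.

Lemma bounded_measurable_sin h l : measurable_fun setT h ->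
  bounded_measurable (fun t => sin (l%:R * h t)).
Proof.
move=> mh; split; last by exists 1 => t; exact: sin_max.
apply: (measurableT_comp (f := sin)).
  by apply: continuous_measurable_fun; exact: continuous_sin.
exact: measurable_funM.
Qed.

Lemma bounded_measurableD f g : bounded_measurable f -> bounded_measurable g ->
  bounded_measurable (fun t => f t + g t).
Proof.
move=> [mf [K fK]] [mg [L gL]]; split; first exact: measurable_funD.
by exists (K + L) => t; rewrite (le_trans (ler_normD _ _))// lerD.
Qed.

Lemma bounded_measurableM f g : bounded_measurable f -> bounded_measurable g ->
  bounded_measurable (fun t => f t * g t).
Proof.
move=> [mf [K fK]] [mg [L gL]]; split; first exact: measurable_funM.
by exists (K * L) => t; rewrite normrM ler_pM.
Qed.

Lemma expectation_linear f g c e :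
  bounded_measurable f -> bounded_measurable g ->
  \int[P]_t (c * f t + e * g t) = c * \int[P]_t f t + e * \int[P]_t g t.
Proof.
move=> bf bg; rewrite RintegralD//; first last.
- by apply: bounded_measurable_integrable; apply: bounded_measurableM => //;
    exact: bounded_measurable_cst.
- by apply: bounded_measurable_integrable; apply: bounded_measurableM => //;
    exact: bounded_measurable_cst.
by rewrite !RintegralZl//; exact: bounded_measurable_integrable.
Qed.

Lemma Rintegral_prob_cst (c : R) : \int[P]_t c = c.
Proof.
rewrite Rintegral_cst// -[RHS]mulr1; congr (_ * _).
have h : fine (P setT) = 1 by rewrite probability_setT.
exact: h.
Qed.

Lemma norm_expectation_le f K : bounded_measurable f ->
  (forall t, `|f t| <= K) -> `|\int[P]_t f t| <= K.
Proof.
move=> bf fK; have [mf _] := bf.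
apply: le_trans (le_normr_Rintegral _ _) _ => //.
  exact: bounded_measurable_integrable.
rewrite -[leRHS]Rintegral_prob_cst.
apply: le_Rintegral => //.
- apply: bounded_measurable_integrable; split; last by exists K => t; rewrite normr_id.
  exact: measurableT_comp.
- by apply: bounded_measurable_integrable; exact: bounded_measurable_cst.
Qed.

Lemma measurable_cos_series a h : cvgn (series (fun l => `|a l|)) ->
  measurable_fun setT h -> measurable_fun setT (fun t => cos_series a (h t)).
Proof.
move=> ca mh; apply: measurable_funD => //; apply: measurable_funM => //.
apply: (measurable_fun_cvg (h := fun n t => cos_psum a (h t) n)) => [n|t _].
  by apply: measurable_sum => l; apply: measurable_funM => //;
    exact: (bounded_measurable_cos _ mh).1.
exact: cvg_cos_psum.
Qed.

Lemma norm_cos_psum_le a u n : cvgn (series (fun l => `|a l|)) ->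
  `|cos_psum a u n| <= limn (series (fun l => `|a l.+1|)).
Proof.
move=> ca; have [ca' _] := cvg_seriesS ca.
rewrite cos_psumS /series/=; apply: le_trans (ler_norm_sum _ _ _) _.
apply: le_trans (nondecreasing_cvgn_le _ ca' n); last first.
  by apply: nondecreasing_series.
apply: ler_sum => l _; rewrite normrM ler_piMr//; exact: cos_max.
Qed.

Lemma bounded_measurable_cos_series a h : cvgn (series (fun l => `|a l|)) ->
  measurable_fun setT h -> bounded_measurable (fun t => cos_series a (h t)).
Proof.
move=> ca mh; split; first exact: measurable_cos_series.
exists (`|a 0%N| + 2 * limn (series (fun l => `|a l.+1|))) => t.
rewrite (le_trans (ler_normD _ _))// lerD// normrM ger0_norm// ler_pM2l//.
have cc := cvg_cos_psum (u := h t) ca.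
rewrite -(cvg_lim _ (cvg_norm cc))//; apply: limr_le; first exact: is_cvg_norm cc.
by apply: nearW => n; exact: norm_cos_psum_le.
Qed.

(** Dominated convergence: absolute summability of [a] bounds the partial sums uniformly in [n] and
    [t], and [g] is bounded. *)
Lemma expectation_cos_series a h g : cvgn (series (fun l => `|a l|)) ->
  measurable_fun setT h -> bounded_measurable g ->
  let m l := \int[P]_t (cos (l%:R * h t) * g t) in
  \int[P]_t (cos_series a (h t) * g t) =
  a 0%N * m 0%N + 2 * limn (series (fun l => a l.+1 * m l.+1)).
Proof.
move=> ca mh bg m; have [mg [K gK]] := bg.
pose f n t := (a 0%N + 2 * cos_psum a (h t) n) * g t.
have bcg l : bounded_measurable (fun t => cos (l%:R * h t) * g t).
  by apply: bounded_measurableM => //; exact: bounded_measurable_cos.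
(* The factor 1 gives the recurrence the shape expected by [expectation_linear]. *)
have fS n t : f n.+1 t =
    1 * f n t + 2 * a n.+1 * (cos (n.+1%:R * h t) * g t).
  by rewrite /f !cos_psumS /series/= big_nat_recr//=; ring.
have f0 t : f 0%N t = a 0%N * (cos (0%:R * h t) * g t).
  by rewrite /f cos_psumS /series/= big_geq// mul0r cos0; ring.
have bf n : bounded_measurable (f n).
  elim: n => [|n IH].
    rewrite (_ : f 0%N = fun t => a 0%N * (cos (0%:R * h t) * g t)); last first.
      exact/funext/f0.
    by apply: bounded_measurableM => //; exact: bounded_measurable_cst.
  have -> := funext (fS n).
  by apply: bounded_measurableD => //; apply: bounded_measurableM => //;
    exact: bounded_measurable_cst.
have Ef n : \int[P]_t f n t =
    a 0%N * m 0%N + 2 * series (fun l => a l.+1 * m l.+1) n.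
  elim: n => [|n IH].
    under eq_Rintegral do rewrite f0.
    rewrite RintegralZl//; last exact: bounded_measurable_integrable.
    by rewrite /series/= big_geq// mulr0 addr0.
  under eq_Rintegral do rewrite fS.
  by rewrite expectation_linear// IH /series/= big_nat_recr//= -/(m _); ring.
pose S := limn (series (fun l => `|a l.+1|)).
have cf : (fun n => \int[P]_t f n t) @ \oo --> \int[P]_t (cos_series a (h t) * g t).
  apply: fine_cvg; rewrite fineK; last first.
    apply: integrable_fin_num => //; apply: bounded_measurable_integrable.
    by apply: bounded_measurableM => //; exact: bounded_measurable_cos_series.
  apply: (@dominated_cvg _ _ _ _ _ _ (fun n t => (f n t)%:E) _
    (fun=> ((`|a 0%N| + 2 * S) * K)%:E)) => //.
  - by move=> n; apply/measurable_EFinP; exact: (bf n).1.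
  - move=> t _; apply: cvg_EFin; first exact: nearW.
    apply: cvgMr_tmp; apply: cvgD; first exact: cvg_cst.
    by apply: cvgMl_tmp; exact: cvg_cos_psum.
  - apply: bounded_measurable_integrable; exact: bounded_measurable_cst.
  - move=> n t _; rewrite abse_EFin lee_fin normrM ler_pM//.
    rewrite (le_trans (ler_normD _ _))// lerD// normrM ger0_norm// ler_pM2l//.
    exact: norm_cos_psum_le.
move: cf; under eq_fun do rewrite Ef.
move=> cf.
(* The series of moments converges because its partial sums are an affine image of the convergent
   integrals; its limit is thus a genuine sum. *)
have cs : series (fun l => a l.+1 * m l.+1) @ \oo -->
    (\int[P]_t (cos_series a (h t) * g t) - a 0%N * m 0%N) / 2.
  rewrite (_ : series _ = (fun n => (a 0%N * m 0%N +
      2 * series (fun l => a l.+1 * m l.+1) n - a 0%N * m 0%N) / 2)).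
    by apply: cvgMr_tmp; apply: cvgB => //; exact: cvg_cst.
  by apply/funext => n; field.
by rewrite (cvg_lim _ cs)//; field.
Qed.

End bounded_measurable.

(** * Integration against a density, and expectations *)

Section integral_density.
Context d (U : measurableType d) (R : realType).
Variables (mu m : {measure set U -> \bar R}) (f : U -> R).
Hypotheses (mf : measurable_fun setT f) (f0 : forall u, 0 <= f u).
Hypothesis mE : forall B, measurable B -> m B = (\int[mu]_(u in B) (f u)%:E)%E.
Local Open Scope ereal_scope.

Import HBNNSimple.

Let integral_density_nnsfun (g : {nnsfun U >-> R}) :
  \int[m]_u (g u)%:E = \int[mu]_u (g u * f u)%R%:E.
Proof.
under eq_integral do rewrite fimfunE -fsumEFin//.
rewrite ge0_integral_fsum//; last 2 first.
- by move=> r; exact/measurable_EFinP/measurableT_comp.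
- by move=> n x _; rewrite EFinM nnfun_muleindic_ge0.
under [RHS]eq_integral.
  move=> x _; rewrite EFinM muleC fimfunE -fsumEFin// ge0_mule_fsumr; last first.
    by move=> r; rewrite EFinM nnfun_muleindic_ge0.
  over.
rewrite ge0_integral_fsum//; last 2 first.
- move=> r; apply/measurable_EFinP; apply: measurable_funM => //.
  by apply/measurableT_comp.
- move=> n x _; rewrite mule_ge0 ?lee_fin// -lee_fin.
  by rewrite EFinM nnfun_muleindic_ge0.
apply: eq_fsbigr => r /[!inE] -[u _ <-].
rewrite integralZl_indic_nnsfun// integral_indic// setIT mE//.
under [RHS]eq_integral do rewrite EFinM muleCA.
rewrite ge0_integralZl ?lee_fin//; last 2 first.
- apply: emeasurable_funM; first exact/measurable_EFinP.
  exact/measurable_EFinP.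
- by move=> v _; rewrite mule_ge0 ?lee_fin.
by congr (_ * _); rewrite integral_mkcond; under eq_integral do
  rewrite epatch_indic.
Qed.

(** The hypothesis [mE] settles indicators, finite sums settle simple functions, and monotone
    convergence along [nnsfun_approx] gives the general case. *)
Lemma integral_density (F : U -> \bar R) : measurable_fun setT F ->
  (forall u, 0 <= F u) -> \int[m]_u F u = \int[mu]_u (F u * (f u)%:E).
Proof.
move=> mF F0; pose g := nnsfun_approx measurableT mF.
have cg u : (EFin \o g^~ u) @ \oo --> F u by exact: cvg_nnsfun_approx.
have ng u : {homo (fun n => (g n u)%:E) : a b / (a <= b)%N >-> a <= b}.
  by move=> a b ab; rewrite lee_fin; exact/lefP/nd_nnsfun_approx.
transitivity (limn (fun n => \int[m]_u (g n u)%:E)).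
  rewrite -monotone_convergence//.
  - by apply: eq_integral => u _; apply/esym/cvg_lim => //; exact: cg.
  - by move=> n; exact/measurable_EFinP.
  - by move=> n u _; rewrite lee_fin.
rewrite (_ : (fun _ => _) = fun n => \int[mu]_u ((g n u)%:E * (f u)%:E)).
  rewrite -monotone_convergence//.
  - apply: eq_integral => u _; apply/cvg_lim => //.
    by apply: cvgeMr => //; exact: cg.
  - move=> n; apply: emeasurable_funM; exact/measurable_EFinP.
  - by move=> n u _; rewrite mule_ge0 ?lee_fin.
  - by move=> u _ a b ab; rewrite lee_wpmul2r ?lee_fin// -lee_fin; exact: ng.
by apply/funext => n; exact: integral_density_nnsfun.
Qed.

End integral_density.

Section density_expectation.
Context d (T : measurableType d) (R : realType) (P : probability T R).
Context d' (U : measurableType d') (mu : {measure set U -> \bar R}).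
Variables (X : T -> U) (f : U -> R).
Hypothesis Xf : has_density P mu X f.

Lemma has_density_integral (F : U -> \bar R) : measurable_fun setT F ->
  (forall u, 0 <= F u)%E ->
  (\int[P]_t F (X t) = \int[mu]_u (F u * (f u)%:E))%E.
Proof.
move=> mF F0; have [mX mf f0 PX] := Xf.
pose m := measure_function_pushforward__canonical__measure_function_Measure P mX.
rewrite -(@integral_density _ _ _ mu m f)//.
by rewrite ge0_integral_pushforward// preimage_setT.
Qed.

Lemma has_density_integrable : mu.-integrable setT (EFin \o f).
Proof.
have [mX mf f0 PX] := Xf; apply/integrableP; split; first exact/measurable_EFinP.
under eq_integral do rewrite gee0_abs ?lee_fin//.
by rewrite -PX// preimage_setT probability_setT ltry.
Qed.

(** The nonnegative case is applied to F + K. The constant contributes K on both sides, since [f]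
    has total mass 1, and cancels. *)
Lemma has_density_expectation (F : U -> R) (K : R) : measurable_fun setT F ->
  (forall u, `|F u| <= K) ->
  mu.-integrable setT (EFin \o (fun u => F u * f u)) /\
  \int[P]_t F (X t) = \int[mu]_u (F u * f u).
Proof.
move=> mF FK; have [mX mf f0 PX] := Xf; have fi := has_density_integrable.
have bF : bounded_measurable (F \o X).
  by split; [exact: measurableT_comp|exists K => t; exact: FK].
have iF : mu.-integrable setT (EFin \o (fun u => F u * f u)).
  apply: (@le_integrable _ _ _ _ _ measurableT _ (EFin \o (fun u => K * f u))).
  - by apply/measurable_EFinP; exact: measurable_funM.
  - move=> u _; rewrite !abse_EFin lee_fin !normrM ler_wpM2r//.
    exact: le_trans (FK u) (ler_norm K).
  - exact: eq_integrable (integrableZl measurableT K fi).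
split => //.
have : (\int[P]_t (1 * F (X t) + K * 1)%:E =
    \int[mu]_u ((1 * F u + K * 1)%:E * (f u)%:E))%E.
  apply: (has_density_integral (F := fun u => (1 * F u + K * 1)%:E)).
    apply/measurable_EFinP; apply: measurable_funD => //.
    exact: measurable_funM.
  move=> u; rewrite lee_fin mul1r mulr1.
  by have := FK u; rewrite ler_norml; lra.
move=> /(congr1 fine); rewrite -/(Rintegral _ _ _) expectation_linear//; last first.
  exact: bounded_measurable_cst.
under eq_integral do rewrite -EFinM mul1r mulr1 mulrDl.
rewrite -[in RHS]/(Rintegral _ _ _) RintegralD//; last first.
  exact: eq_integrable (integrableZl measurableT K fi).
rewrite [in RHS]RintegralZl// mul1r.
have <- : \int[P]_t (1 : R) = \int[mu]_u f u.
  rewrite Rintegral_prob_cst /Rintegral -PX// preimage_setT.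
  by rewrite probability_setT.
exact: addIr.
Qed.

End density_expectation.

(** * Fourier coefficients of the uniform phase and of the phase noise *)

Section phases.
Context d (T : measurableType d) (R : realType) (P : probability T R).
Implicit Types (theta phi : {RV P >-> R}) (l : nat).

Lemma sin_natpi l : sin (l%:R * pi) = 0 :> R.
Proof.
elim: l => [|l IH]; first by rewrite mul0r sin0.
by rewrite -natr1 mulrDl mul1r sinD IH sinpi mul0r mulr0 addr0.
Qed.

(** By the fundamental theorem of calculus, a function whose primitive takes equal values at both
    ends of the interval has mean zero. *)
Lemma expectation_uniform_phase theta (F G : R -> R) (K : R) :
  uniform_phase theta -> (forall x : R, is_derive x (1 : R) F (G x)) -> continuous G ->
  (forall x, `|G x| <= K) -> F (- pi) = F pi ->
  \int[P]_t G (theta t) = 0.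
Proof.
move=> ut dF cG GK Fpi.
have pipi : - pi < pi :> R by have := pi_gt0 R; lra.
have mG : measurable_fun setT G by exact: continuous_measurable_fun.
have [_ ->] := has_density_expectation ut mG GK.
have -> : \int[lebesgue_measure]_u (G u * uniform_pdf (- pi) pi u) =
    \int[lebesgue_measure]_(u in `[- pi, pi]) ((pi - - pi)^-1 * G u).
  rewrite [RHS]Rintegral_mkcond; apply: eq_Rintegral => u _.
  rewrite patchE mem_setE/= in_itv/= /uniform_pdf.
  by case: ifPn => _; rewrite ?mulr0// mulrC.
have cGw : {within `[- pi, pi], continuous G} by exact: continuous_subspaceT.
rewrite RintegralZl//; last first.
  by apply: continuous_compact_integrable => //; exact: segment_compact.
rewrite /Rintegral (continuous_FTC2 (F := F))//.
- by rewrite Fpi subee//= mulr0.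
- have cF : continuous F.
    by move=> x; apply: differentiable_continuous; apply/derivable1_diffP;
      have [] := dF x.
  split; first by move=> x _; have [] := dF x.
    exact: cvg_at_right_filter (cF _).
  exact: cvg_at_left_filter (cF _).
- by move=> x _; rewrite derive1E; have [_ ->] := dF x.
Qed.

Lemma is_derive_dilation (f : R -> R) (c x df : R) :
  is_derive (c * x) (1 : R) f df ->
  is_derive x (1 : R) (fun y => f (c * y)) (c * df).
Proof.
move=> dff; have dc : is_derive x (1 : R) (fun y : R => c * y) c.
  apply: (is_derive_eq (is_deriveZ c (is_derive_id x (1 : R)))).
  by rewrite /GRing.scale/= mulr1.
by rewrite mulrC; exact: (@is_derive1_comp _ f _ x df c).
Qed.

Lemma is_derive_scaled_dilation (f : R -> R) (c x df : R) : c != 0 ->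
  is_derive (c * x) (1 : R) f df ->
  is_derive x (1 : R) (fun y => c^-1 * f (c * y)) df.
Proof.
move=> c0 /is_derive_dilation/(is_deriveZ c^-1) dff.
by apply: (is_derive_eq dff); rewrite /GRing.scale/= mulKf.
Qed.

Lemma expectation_cos_uniform_phase theta l : uniform_phase theta ->
  \int[P]_t cos (l.+1%:R * theta t) = 0.
Proof.
move=> ut.
apply: (expectation_uniform_phase (F := fun x => l.+1%:R^-1 * sin (l.+1%:R * x))
  (G := fun x => cos (l.+1%:R * x)) (K := 1)) => //.
- by move=> x; apply: is_derive_scaled_dilation; rewrite ?pnatr_eq0.
- move=> x; apply: continuous_comp; last exact: continuous_cos.
  exact: cvgMl_tmp.
- by move=> x; exact: cos_max.
- by rewrite mulrN sinN sin_natpi oppr0.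
Qed.

Lemma expectation_sin_uniform_phase theta l : uniform_phase theta ->
  \int[P]_t sin (l.+1%:R * theta t) = 0.
Proof.
move=> ut.
apply: (expectation_uniform_phase (F := fun x => l.+1%:R^-1 * (- cos) (l.+1%:R * x))
  (G := fun x => sin (l.+1%:R * x)) (K := 1)) => //.
- move=> x; apply: is_derive_scaled_dilation; first by rewrite pnatr_eq0.
  by apply: is_derive_eq; rewrite opprK.
- move=> x; apply: continuous_comp; last exact: continuous_sin.
  exact: cvgMl_tmp.
- by move=> x; exact: sin_max.
- by congr (_ * - _); rewrite mulrN cosN.
Qed.

Section phase_noise.
Variables (alpha : nat -> R) (phi : {RV P >-> R}).
Hypothesis pn : phase_noise alpha phi.
Local Notation p := (phase_noise_pdf alpha).

Let integral_phase_noise_pdf (F : R -> R) :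
  \int[lebesgue_measure]_u (F u * p u) =
  \int[lebesgue_measure]_(u in `[- pi, pi[) (F u * p u).
Proof.
rewrite [RHS]Rintegral_mkcond; apply: eq_Rintegral => u _.
rewrite patchE mem_setE/= in_itv/= /phase_noise_pdf.
by case: ifPn => _ //; rewrite mulr0.
Qed.

Lemma expectation_cos_phase_noise l : \int[P]_t cos (l%:R * phi t) = alpha l.
Proof.
have [_ ac ad] := pn.
have mc : measurable_fun setT (fun x : R => cos (l%:R * x)).
  apply: continuous_measurable_fun => x.
  by apply: continuous_comp; [exact: cvgMl_tmp|exact: continuous_cos].
have [_ ->] := has_density_expectation ad mc (fun x => cos_max _).
rewrite integral_phase_noise_pdf ac.
by apply: eq_Rintegral => u _; rewrite mulrC.
Qed.

(** The integrand is odd and Lebesgue measure is invariant under negation, so the integral equals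
    its own opposite. *)
Lemma expectation_sin_phase_noise l : \int[P]_t sin (l%:R * phi t) = 0.
Proof.
have [_ ac ad] := pn; have [_ mp _ _] := ad.
have mc : measurable_fun setT (fun x : R => sin (l%:R * x)).
  apply: continuous_measurable_fun => x.
  by apply: continuous_comp; [exact: cvgMl_tmp|exact: continuous_sin].
have [ic ->] := has_density_expectation ad mc (fun x => sin_max _).
rewrite integral_phase_noise_pdf.
pose g u := sin (l%:R * u) * p u.
have ig (A : set R) : measurable A ->
  lebesgue_measure.-integrable A (EFin \o g).
  by move=> mA; exact: integrableS ic.
rewrite -Rintegral_itv_obnd_cbnd; last by apply: ig; exact: measurable_itv.
set I := LHS; suff : I = - I by lra.
rewrite {1}/I /Rintegral.
(* The pdf vanishes at pi but not necessarily at - pi, so it is even only on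
   the open interval. *)
pose D : set R := `]- pi, pi[%classic.
pose opp : R -> measurableTypeR R := -%R.
have mopp : measurable_fun setT opp by exact: oppr_measurable.
transitivity (fine (\int[pushforward lebesgue_measure opp]_(u in D)
   (g u)%:E)%E).
  congr fine; apply: eq_measure_integral => A mA _.
  exact: esym (lebesgue_measureN _).
have e : opp @^-1` D = D.
  by rewrite /opp /D opp_preimage_itvbndbnd/= opprK.
have gN (u : R) : u \in D -> g (opp u) = -1 * g u.
  rewrite inE /D/= in_itv/= => /andP[u1 u2].
  rewrite mulN1r /g /opp mulrN sinN mulNr /phase_noise_pdf.
  rewrite (ltW u1) u2 ltrNl u1 lerNr opprK (ltW u2) /=; congr (- (_ * (_ * _))).
  rewrite /cos_series; congr (_ + _ * _); congr (limn _).
  by apply/funext => n; apply: eq_bigr => k _; rewrite mulrN cosN.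
rewrite integral_pushforward//.
- rewrite e -[RHS]mulN1r -RintegralZl//; last exact: ig.
  exact: eq_Rintegral.
- by apply/measurable_EFinP; exact: measurable_funM.
- have mD : measurable (D : set (measurableTypeR R)) by exact: measurable_itv.
  rewrite e; apply: eq_integrable (integrableZl mD (-1) (ig _ mD)) => //.
  by move=> u uD /=; rewrite -EFinM -(gN _ uD).
- exact: measurable_itv.
Qed.

(** The coefficient is the mean of a cosine. This bound lets the Bessel factors dominate every
    series that involves [alpha]. *)
Lemma norm_phase_noise_coef_le1 l : `|alpha l| <= 1.
Proof.
rewrite -expectation_cos_phase_noise; apply: norm_expectation_le => [|t].
  exact: bounded_measurable_cos.
exact: cos_max.
Qed.

End phase_noise.
End phases.

(** * Averages of the exponentials of cosines *)

Section averages.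
Context d (T : measurableType d) (R : realType) (P : probability T R).
Implicit Types (theta phi : {RV P >-> R}).

Lemma integral_bounded_measurable (f : T -> R) : bounded_measurable f ->
  (\int[P]_t (f t)%:E)%E = (\int[P]_t f t)%:E.
Proof.
move=> bf; rewrite fineK//; apply: integrable_fin_num => //.
exact: bounded_measurable_integrable.
Qed.

Lemma bounded_measurable_expcos (h : T -> R) x : measurable_fun setT h ->
  bounded_measurable (fun t => expR (x * cos (h t))).
Proof.
move=> mh; have [mc _] := bounded_measurable_cos 1 mh.
split.
  apply: measurableT_comp => //; apply: measurable_funM => //.
  by under [X in measurable_fun _ X]eq_fun do rewrite -[h _]mul1r.
exists (expR `|x|) => t; rewrite ger0_norm ?expR_ge0// ler_expR.
by rewrite (le_trans (ler_norm _))// normrM ler_piMr// cos_max.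
Qed.

Lemma expectation_cos_affine (h : T -> R) l c : measurable_fun setT h ->
  \int[P]_t cos (l%:R * h t + c) =
  cos c * \int[P]_t cos (l%:R * h t) - sin c * \int[P]_t sin (l%:R * h t).
Proof.
move=> mh; rewrite -mulNr -expectation_linear.
- by apply: eq_Rintegral => t _; rewrite cosD; ring.
- exact: bounded_measurable_cos.
- exact: bounded_measurable_sin.
Qed.

Lemma expectation_cos_uniform_affine theta l c : uniform_phase theta ->
  \int[P]_t cos (l.+1%:R * theta t + c) = 0.
Proof.
move=> ut; rewrite expectation_cos_affine// expectation_cos_uniform_phase//.
by rewrite expectation_sin_uniform_phase// !mulr0 subr0.
Qed.

Lemma expectation_cos_distn_uniform theta j k c : uniform_phase theta ->
  j != k -> \int[P]_t cos (j%:R * theta t - k%:R * theta t + c) = 0.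
Proof.
move=> ut; rewrite neq_ltn => /orP[|] jk.
  have [l kE] : exists l, k = (j + l.+1)%N by exists (k - j).-1; lia.
  rewrite -[RHS](expectation_cos_uniform_affine l (- c) ut).
  by apply: eq_Rintegral => t _; rewrite -cosN kE natrD; congr cos; ring.
have [l jE] : exists l, j = (k + l.+1)%N by exists (j - k).-1; lia.
rewrite -[RHS](expectation_cos_uniform_affine l c ut).
by apply: eq_Rintegral => t _; rewrite jE natrD; congr cos; ring.
Qed.

(** Orthogonality of the cosines, by the product-to-sum formula: the frequency j + k averages out
    unless j = k = 0, the frequency j - k unless j = k. When both are 0 each half contributes 1/2,
    which explains the separate case. *)
Lemma expectation_cosM_uniform theta j k b c : uniform_phase theta ->
  \int[P]_t (cos (j%:R * (theta t + b)) * cos (k%:R * (theta t + c))) =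
  if j == k then (if k is 0 then 1 else cos (k%:R * (b - c)) / 2) else 0.
Proof.
move=> ut.
pose f t := cos ((j + k)%:R * theta t + (j%:R * b + k%:R * c)).
pose g t := cos (j%:R * theta t - k%:R * theta t + (j%:R * b - k%:R * c)).
have mth : measurable_fun setT theta by [].
have bcos (h : T -> R) : measurable_fun setT h ->
    bounded_measurable (fun t => cos (h t)).
  move=> mh; have := bounded_measurable_cos 1 mh.
  by under eq_fun do rewrite mul1r.
have bf : bounded_measurable f.
  by apply: bcos; apply: measurable_funD => //; exact: measurable_funM.
have bg : bounded_measurable g.
  apply: bcos; apply: measurable_funD => //; apply: measurable_funB => //;
  exact: measurable_funM.
transitivity (\int[P]_t (2^-1 * f t + 2^-1 * g t)).
  apply: eq_Rintegral => t _; rewrite /f /g.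
  set u := j%:R * (theta t + b); set v := k%:R * (theta t + c).
  have -> : (j + k)%:R * theta t + (j%:R * b + k%:R * c) = u + v.
    by rewrite /u /v natrD; ring.
  have -> : j%:R * theta t - k%:R * theta t + (j%:R * b - k%:R * c) = u - v.
    by rewrite /u /v; ring.
  by rewrite cosD cosB; lra.
rewrite expectation_linear//; have [jk|jk] := eqVneq j k; last first.
  rewrite [X in _ + _ * X]expectation_cos_distn_uniform// mulr0 addr0 /f.
  have [l ->] : exists l, (j + k = l.+1)%N.
    by exists (j + k).-1; lia.
  by rewrite expectation_cos_uniform_affine// mulr0.
subst j.
have -> : \int[P]_t g t = cos (k%:R * (b - c)).
  rewrite -[RHS](Rintegral_prob_cst P); apply: eq_Rintegral => t _.
  by rewrite /g; congr cos; ring.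
case: k @f {bf bg g} => [|k] f.
  rewrite mul0r cos0 (_ : \int[P]_t f t = 1); first by lra.
  rewrite -[RHS](Rintegral_prob_cst P); apply: eq_Rintegral => t _.
  by rewrite /f !mul0r !addr0 cos0.
rewrite /f addSn expectation_cos_uniform_affine//; lra.
Qed.

Lemma limn_near_cst (u : R^nat) N l : (forall n, (N <= n)%N -> u n = l) ->
  limn u = l.
Proof.
move=> uN; apply/cvg_lim => //; apply: cvg_near_cst.
by exists N => // n /= Nn; exact/uN.
Qed.

Lemma expectation_besselI_uniform theta x y b c : 0 <= x -> 0 <= y ->
  uniform_phase theta ->
  \int[P]_t (expR (x * cos (theta t + b)) * expR (y * cos (theta t + c))) =
  cos_series (fun l => besselI l x * besselI l y) (b - c).
Proof.
move=> x0 y0 ut; have mth : measurable_fun setT theta by [].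
have sI (v : R) : 0 <= v -> cvgn (series (fun l => `|besselI l v|)).
  move=> v0; under eq_fun do rewrite ger0_norm ?besselI_ge0//.
  exact: cvg_series_besselI.
have mthD e : measurable_fun setT (fun t => theta t + e).
  exact: measurable_funD.
(* The exponentials are expanded one at a time. Here the second one is expanded against a single
   cosine: only the order l survives, and for l > 0 the factor 2 of [cos_series] cancels the 1/2
   from orthogonality. *)
have m_cos l : \int[P]_t (cos (l%:R * (theta t + b)) *
    expR (y * cos (theta t + c))) = besselI l y * cos (l%:R * (b - c)).
  under eq_Rintegral do rewrite mulrC jacobi_anger//.
  rewrite (expectation_cos_series P (sI _ y0) (mthD c))//; last first.
    exact: bounded_measurable_cos.
  have E k : \int[P]_t (cos (k%:R * (theta t + c)) * cos (l%:R * (theta t + b)))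
      = if k == l then (if l is 0 then 1 else cos (l%:R * (c - b)) / 2) else 0.
    exact: expectation_cosM_uniform.
  rewrite E; under eq_fun do rewrite E.
  case: l {E} => [|l] /=.
    rewrite (@limn_near_cst _ 0 0) ?mulr0 ?addr0 ?mul0r ?cos0// => n _.
    by rewrite /series/= big1// => k _; rewrite mulr0.
  (* In the shifted series the order [l.+1] sits at index [l], so the partial sums are constant from
     [l.+1] on. *)
  rewrite mulr0 add0r (@limn_near_cst _ l.+1
    (besselI l.+1 y * (cos (l.+1%:R * (c - b)) / 2))) => [|n ln].
    by rewrite -opprB mulrN cosN; lra.
  rewrite /series/= (bigD1_seq l) ?iota_uniq ?mem_index_iota//=.
  rewrite eqxx big1 ?addr0// => k /negPf kl.
  by rewrite eqSS kl mulr0.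
under eq_Rintegral do rewrite jacobi_anger//.
rewrite (expectation_cos_series P (sI _ x0) (mthD b))//; last first.
  exact: bounded_measurable_expcos.
rewrite m_cos mul0r cos0 mulr1 /cos_series cos_psumS.
congr (_ + 2 * _); congr (limn _); congr series; apply/funext => l.
by rewrite m_cos mulrA.
Qed.

Section phase_noise.
Variables (alpha : nat -> R) (phi : {RV P >-> R}).
Hypothesis pn : phase_noise alpha phi.

Lemma expectation_cos_series_phase_noise (c : R^nat) z :
  cvgn (series (fun l => `|c l|)) ->
  \int[P]_t cos_series c (phi t - z) = cos_series (fun l => alpha l * c l) z.
Proof.
move=> sc; have mp : measurable_fun setT phi by [].
have mpz : measurable_fun setT (fun t => phi t - z) by exact: measurable_funB.
have := expectation_cos_series P sc mpz (bounded_measurable_cst _ 1).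
under eq_Rintegral do rewrite mulr1.
move=> ->.
have E l : \int[P]_t (cos (l%:R * (phi t - z)) * 1) = alpha l * cos (l%:R * z).
  under eq_Rintegral do rewrite mulr1 mulrBr.
  rewrite expectation_cos_affine// (expectation_cos_phase_noise pn).
  by rewrite (expectation_sin_phase_noise pn) mulr0 subr0 cosN mulrC.
rewrite E mul0r cos0 mulr1 /cos_series cos_psumS mulrC.
congr (_ + 2 * _); congr (limn _); congr series; apply/funext => l.
by rewrite E mulrA [c _ * _]mulrC.
Qed.

Lemma expectation_expcos_phase_noise x z : 0 <= x ->
  \int[P]_t expR (x * cos (phi t - z)) =
  cos_series (fun l => alpha l * besselI l x) z.
Proof.
move=> x0; rewrite -expectation_cos_series_phase_noise.
  by apply: eq_Rintegral => t _; rewrite jacobi_anger.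
under eq_fun do rewrite ger0_norm ?besselI_ge0//.
exact: cvg_series_besselI.
Qed.

End phase_noise.
End averages.

(** * Densities given the hidden variables *)

Section complex_plane.
Variable R : realType.
Implicit Types (z w x y s : R[i]) (a t : R).
Local Open Scope complex_scope.

Lemma cmod_sqr z : cmod z ^+ 2 = complex.Re z ^+ 2 + complex.Im z ^+ 2.
Proof. by case: z => u v; rewrite /cmod/= sqr_sqrtr// addr_ge0// sqr_ge0. Qed.

Lemma cmod_ge0 z : 0 <= cmod z.
Proof. by case: z => u v; exact: sqrtr_ge0. Qed.

Lemma cmodM z w : cmod (z * w) = cmod z * cmod w.
Proof. exact: complex.ComplexField.Normc.normcM. Qed.

Lemma cmod_conj z : cmod z^* = cmod z.
Proof. by case: z => u v; rewrite /cmod/= sqrrN. Qed.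

(** The arccosine fixes the cosine and gives the sine |Im z| / |z|; the branch in [carg] restores
    the sign of Im z. At z = 0 both sides vanish whatever the value of [carg]. *)
Lemma cmod_polar z :
  z = (cmod z * cos (carg z)) +i* (cmod z * sin (carg z)).
Proof.
have [z0|z0] := eqVneq (cmod z) 0.
  have := cmod_sqr z; rewrite z0 expr0n/= !mul0r => /esym/eqP.
  rewrite paddr_eq0 ?sqr_ge0// !sqrf_eq0 => /andP[/eqP u0 /eqP v0].
  by case: z z0 u0 v0 => u v /= _ -> ->.
have zp : 0 < cmod z by rewrite lt_def z0 cmod_ge0.
have e := cmod_sqr z.
have b : -1 <= complex.Re z / cmod z <= 1.
  rewrite -ler_norml normrM normfV (ger0_norm (cmod_ge0 z)) ler_pdivrMr// mul1r.
  by rewrite -ler_sqr ?nnegrE ?cmod_ge0// -normrX ger0_norm ?sqr_ge0// e lerDl sqr_ge0.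
have s2 : Num.sqrt (1 - (complex.Re z / cmod z) ^+ 2) = `|complex.Im z| / cmod z.
  rewrite -[RHS]ger0_norm ?divr_ge0 ?cmod_ge0// -sqrtr_sqr; congr Num.sqrt.
  rewrite !exprMn exprVn -normrX (ger0_norm (sqr_ge0 _)).
  have : cmod z ^+ 2 != 0 by rewrite expf_neq0.
  by move: e; move: (cmod z ^+ 2) => r -> r0; field.
have ca : cos (acos (complex.Re z / cmod z)) = complex.Re z / cmod z.
  by rewrite acosK// in_itv.
have sa : sin (acos (complex.Re z / cmod z)) = `|complex.Im z| / cmod z.
  by rewrite sin_acos.
rewrite [LHS](_ : _ = complex.Re z +i* complex.Im z); last by case: (z).
rewrite /carg; case: ifPn => [v0|]; rewrite ?cosN ?sinN ca sa.
  rewrite ger0_norm// !(mulrC (cmod z)) !divfK//.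
rewrite -ltNge => v0; rewrite ltr0_norm// mulNr opprK.
by rewrite !(mulrC (cmod z)) !divfK.
Qed.

Lemma cmod_cexpi t : cmod (cexpi t) = 1 :> R.
Proof. by rewrite /cmod/= cos2Dsin2 sqrtr1. Qed.

(** The law of cosines. It holds for every real amplitude [a], negative ones included. *)
Lemma cmod_sub_phase_sqr x a t :
  cmod (x - a%:C * cexpi t) ^+ 2 =
  cmod x ^+ 2 + a ^+ 2 - 2 * a * cmod x * cos (t - carg x).
Proof.
rewrite cmod_sqr cosB [in LHS](cmod_polar x) /cexpi; simpc => /=.
move: (cmod x) (cos2Dsin2 t) (cos2Dsin2 (carg x)) => r.
move: (cos t) (sin t) (cos (carg x)) (sin (carg x)) => c s C S e1 e2.
transitivity (r ^+ 2 * (C ^+ 2 + S ^+ 2) + a ^+ 2 * (c ^+ 2 + s ^+ 2)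
  - 2 * a * r * (c * C + s * S)); first by ring.
by rewrite e1 e2 !mulr1.
Qed.

Definition gauss1 z : R := pi^-1 * expR (- cmod z ^+ 2).

Lemma gauss1_ge0 z : 0 <= gauss1 z.
Proof. by rewrite mulr_ge0 ?expR_ge0// invr_ge0 pi_ge0. Qed.

Lemma gaussian_pdf_prod M (v : M.-tuple R[i]) :
  gaussian_pdf v = \prod_(m < M) gauss1 (tnth v m).
Proof.
rewrite /gaussian_pdf /gauss1 big_split/= prodr_const card_ord exprVn; congr (_ * _).
by rewrite -expR_sum/= /norm2 sumrN.
Qed.

Lemma gauss1_constant_channel x y s a theta phi :
  gauss1 (x - a%:C * cexpi theta) *
  gauss1 (y - a%:C * cexpi (theta + phi) * s) =
  pi ^- 2 * expR (- cmod x ^+ 2 - cmod y ^+ 2 - a ^+ 2 * (1 + cmod s ^+ 2)) *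
  (expR (2 * a * cmod x * cos (theta - carg x)) *
   expR (2 * a * cmod (s^* * y) * cos (theta + (phi + carg s - carg y)))).
Proof.
(* The polar form of [s] makes the second mean a real amplitude times a phase, so that the law of
   cosines applies to both factors. *)
have -> : a%:C * cexpi (theta + phi) * s =
    (a * cmod s)%:C * cexpi (theta + phi + carg s).
  rewrite {1}(cmod_polar s) [in RHS]cexpiD; case: (cexpi (theta + phi)) => c d.
  by rewrite /cexpi; simpc; congr (_ +i* _); ring.
rewrite /gauss1 !cmod_sub_phase_sqr mulrACA -invfM -expr2 -[RHS]mulrA -!expRD.
congr (_ * expR _).
rewrite cmodM cmod_conj.
have -> : theta + (phi + carg s - carg y) = theta + phi + carg s - carg y by ring.
by ring.
Qed.

(** Here [w] stands for the symbol rotated by the phase noise. [D] is the coefficient of |h|^2, and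
    [c] combines the two observations so that the cross terms are -2a Re (h^* c); the square is
    therefore centred at a c / D. *)
Lemma complete_square_fading x y w h a :
  let D := a ^+ 2 + a ^+ 2 * cmod w ^+ 2 + 1 in
  let c := x + w^* * y in
  D != 0 ->
  cmod h ^+ 2 + (cmod (x - a%:C * h) ^+ 2 + cmod (y - a%:C * w * h) ^+ 2) =
  D * (complex.Re h - a * complex.Re c / D) ^+ 2 +
  D * (complex.Im h - a * complex.Im c / D) ^+ 2 +
  (cmod x ^+ 2 + cmod y ^+ 2 - a ^+ 2 * cmod c ^+ 2 / D).
Proof.
move=> D c; rewrite /D /c !cmod_sqr.
case: x y w h {D c} => [x1 x2] [y1 y2] [w1 w2] [u v]; simpc => /= D0.
by field.
Qed.

Lemma cmod_add_phase_sqr x y s t :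
  cmod (x + (cexpi t * s)^* * y) ^+ 2 =
  cmod x ^+ 2 + cmod s ^+ 2 * cmod y ^+ 2 +
  2 * cmod (s^* * x^* * y) * cos (t - (carg y - carg x - carg s)).
Proof.
(* A negative amplitude turns the sum into the difference handled by [cmod_sub_phase_sqr]. *)
have -> : x + (cexpi t * s)^* * y = x -
    (- (cmod s * cmod y))%:C * cexpi (carg y - carg s - t).
  congr (_ + _); rewrite {1}(cmod_polar s) {1}(cmod_polar y) !cexpiD.
  rewrite /cexpi !cosN !sinN; simpc; congr (_ +i* _); ring.
rewrite cmod_sub_phase_sqr !cmodM !cmod_conj -[cos (t - _)]cosN.
have -> : - (t - (carg y - carg x - carg s)) = carg y - carg s - t - carg x.
  by ring.
by ring.
Qed.

(** After completing the square, [h] occurs only in a Gaussian of precision [D]. Subtracting rho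
    |c|^2 / D leaves 1 - rho / D on |x|^2 and 1 - rho |s|^2 / D on |y|^2, while the cross term of
    |c|^2 carries all the remaining dependence on the phase. *)
Lemma gauss1_fading_channel x y s rho t h : 0 < rho ->
  let D := rho + rho * cmod s ^+ 2 + 1 in
  let c := x + (cexpi t * s)^* * y in
  gauss1 h * (gauss1 (x - (Num.sqrt rho)%:C * h) *
    gauss1 (y - (Num.sqrt rho)%:C * cexpi t * h * s)) =
  pi ^- 3 * expR (- ((1 + rho * cmod s ^+ 2) / D) * cmod x ^+ 2
      - (1 + rho) / D * cmod y ^+ 2) *
  expR (2 * rho * cmod (s^* * x^* * y) / D *
        cos (t - (carg y - carg x - carg s))) *
  (expR (- (D * (complex.Re h - Num.sqrt rho * complex.Re c / D) ^+ 2)) *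
   expR (- (D * (complex.Im h - Num.sqrt rho * complex.Im c / D) ^+ 2))).
Proof.
move=> rho0 D c; set a := Num.sqrt rho.
have a2 : rho = a ^+ 2 by rewrite sqr_sqrtr// ltW.
have ew : cmod (cexpi t * s) = cmod s by rewrite cmodM cmod_cexpi mul1r.
have DE : D = a ^+ 2 + a ^+ 2 * cmod (cexpi t * s) ^+ 2 + 1.
  by rewrite /D ew -a2.
have D0 : D != 0.
  by rewrite /D; have := sqr_ge0 (cmod s); move=> h2; rewrite gt_eqF//; nra.
have -> : a%:C * cexpi t * h * s = a%:C * (cexpi t * s) * h by ring.
transitivity (pi ^- 3 * expR (- (cmod h ^+ 2 + (cmod (x - a%:C * h) ^+ 2 +
    cmod (y - a%:C * (cexpi t * s) * h) ^+ 2)))).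
  by rewrite /gauss1 !opprD !expRD -exprVn; ring.
rewrite complete_square_fading -DE// -/c cmod_add_phase_sqr -a2.
rewrite -!mulrA -!expRD; congr (_ * expR _).
set q := cmod (s^* * x^* * y); set e := cos _.
set u := _ ^+ 2; set v := _ ^+ 2.
by move: D0; rewrite /D; move=> D0; field.
Qed.

End complex_plane.

(** * Measurability and integration on C and C^M *)

Section measurable_complex.
Context d (T : measurableType d) (R : realType).
Implicit Types (f g : T -> R[i]) (h k : T -> R).
Local Open Scope complex_scope.

Lemma measurable_complexP f : measurable_fun setT f <->
  measurable_fun setT (fun t => complex.Re (f t)) /\
  measurable_fun setT (fun t => complex.Im (f t)).
Proof.
split=> [mf|[mr mi]].
  have mrf : measurable_fun setT (@reim R \o f).
    by apply: measurableT_comp => //; exact: measurable_reim.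
  split.
    exact: (measurableT_comp measurable_fst mrf).
  exact: (measurableT_comp measurable_snd mrf).
rewrite (_ : f = @ofreim R \o (fun t => (complex.Re (f t), complex.Im (f t)))).
  apply: measurableT_comp; first exact: measurable_ofreim.
  exact: measurable_fun_pair.
by apply/funext => t /=; rewrite /ofreim/=; case: (f t).
Qed.

Lemma measurable_complexD f g : measurable_fun setT f -> measurable_fun setT g ->
  measurable_fun setT (fun t => f t + g t).
Proof.
move=> /measurable_complexP[fr fi] /measurable_complexP[gr gi].
apply/measurable_complexP; split.
  rewrite (_ : (fun t => _) = (fun t => complex.Re (f t) + complex.Re (g t))).
    exact: measurable_funD.
  by apply/funext => t; case: (f t) => ? ?; case: (g t).
rewrite (_ : (fun t => _) = (fun t => complex.Im (f t) + complex.Im (g t))).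
  exact: measurable_funD.
by apply/funext => t; case: (f t) => ? ?; case: (g t).
Qed.

Lemma measurable_complexN f : measurable_fun setT f ->
  measurable_fun setT (fun t => - f t).
Proof.
move=> /measurable_complexP[fr fi]; apply/measurable_complexP; split.
  rewrite (_ : (fun t => _) = (fun t => - complex.Re (f t))).
    exact: measurableT_comp fr.
  by apply/funext => t; case: (f t) => ? ?.
rewrite (_ : (fun t => _) = (fun t => - complex.Im (f t))).
  exact: measurableT_comp fi.
by apply/funext => t; case: (f t) => ? ?.
Qed.

Lemma measurable_complexM f g : measurable_fun setT f -> measurable_fun setT g ->
  measurable_fun setT (fun t => f t * g t).
Proof.
move=> /measurable_complexP[fr fi] /measurable_complexP[gr gi].
apply/measurable_complexP; split.
  rewrite (_ : (fun t => _) = (fun t => complex.Re (f t) * complex.Re (g t) -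
      complex.Im (f t) * complex.Im (g t))).
    by apply: measurable_funB; exact: measurable_funM.
  by apply/funext => t; case: (f t) => ? ?; case: (g t).
rewrite (_ : (fun t => _) = (fun t => complex.Re (f t) * complex.Im (g t) +
    complex.Im (f t) * complex.Re (g t))).
  by apply: measurable_funD; exact: measurable_funM.
by apply/funext => t; case: (f t) => ? ?; case: (g t).
Qed.

Lemma measurable_cexpi h : measurable_fun setT h ->
  measurable_fun setT (fun t => cexpi (h t)).
Proof.
move=> mh; apply/measurable_complexP; split => /=.
  apply: (measurableT_comp (f := cos)) mh.
  by apply: continuous_measurable_fun; exact: continuous_cos.
apply: (measurableT_comp (f := sin)) mh.
by apply: continuous_measurable_fun; exact: continuous_sin.
Qed.

Lemma measurable_gauss1 f : measurable_fun setT f ->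
  measurable_fun setT (fun t => gauss1 (f t)).
Proof.
move=> /measurable_complexP[fr fi].
have mf2 : measurable_fun setT (fun t => cmod (f t) ^+ 2).
  under eq_fun do rewrite cmod_sqr.
  by apply: measurable_funD; exact: measurable_funX.
apply: measurable_funM => //; apply: (measurableT_comp (f := expR)) => //.
exact: measurableT_comp mf2.
Qed.

End measurable_complex.

(** * Translation invariance of Lebesgue measure on R, C and C^M *)

Section lebesgue_translation.
Variable R : realType.
Local Notation leb := (@lebesgue_measure R).
Local Open Scope ereal_scope.

(** By uniqueness of Lebesgue measure, it suffices that translation preserves the lengths of
    half-open intervals. *)
Lemma lebesgue_measure_translation (a : R) (A : set (measurableTypeR R)) :
  measurable A ->
  pushforward leb ((fun x => x + a)%R : R -> measurableTypeR R) A = leb A.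
Proof.
have ma : measurable_fun setT ((fun x => x + a)%R : R -> measurableTypeR R).
  exact: measurable_funD.
move=> mA; apply/esym.
apply: (@lebesgue_measure_unique _
  (measure_function_pushforward__canonical__measure_function_Measure leb ma)) => //.
move=> _ [[b c]] _ <-.
rewrite /= /pushforward.
have -> : (fun x : R => x + a)%R @^-1` `]b, c] = `](b - a)%R, (c - a)%R]%classic.
  by apply/seteqP; split => x /=; rewrite !in_itv/=; lra.
rewrite !lebesgue_measure_itv/= !lte_fin ltrD2r.
by case: ifPn => // _; rewrite -!EFinD; congr EFin; ring.
Qed.

Lemma integral_lebesgue_translation (a : R) (F : R -> \bar R) :
  measurable_fun setT F -> (forall x, 0 <= F x) ->
  \int[leb]_x F (x + a)%R = \int[leb]_x F x.
Proof.
move=> mF F0.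
have ma : measurable_fun setT ((fun x => x + a)%R : R -> measurableTypeR R).
  exact: measurable_funD.
transitivity (\int[pushforward leb
    ((fun x => x + a)%R : R -> measurableTypeR R)]_x F x).
  by rewrite ge0_integral_pushforward// preimage_setT.
apply: eq_measure_integral => A mA _; exact: lebesgue_measure_translation.
Qed.

Lemma integral_lebesgue_complex (F : R[i] -> \bar R) :
  measurable_fun setT F -> (forall z, 0 <= F z) ->
  \int[@lebesgue_complex R]_z F z =
  \int[leb]_u \int[leb]_v F (Complex u v).
Proof.
move=> mF F0.
pose m := measure_function_pushforward__canonical__measure_function_Measure
  (leb \x leb) (@measurable_ofreim R).
transitivity (\int[m]_z F z); first by apply: eq_measure_integral => A mA _.
rewrite ge0_integral_pushforward//.
rewrite preimage_setT fubini_tonelli1//.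
  by apply: measurableT_comp => //; exact: measurable_ofreim.
  by move=> x; exact: F0.
exact: measurable_ofreim.
Qed.

Lemma integral_lebesgue_complex_translation (c : R[i]) (F : R[i] -> \bar R) :
  measurable_fun setT F -> (forall z, 0 <= F z) ->
  \int[@lebesgue_complex R]_z F (z + c)%R = \int[@lebesgue_complex R]_z F z.
Proof.
move=> mF F0; case: c => a b.
have mFc : measurable_fun setT (fun z : R[i] => F (z + Complex a b)%R).
  by apply: measurableT_comp => //; exact: measurable_complexD.
have m2 : measurable_fun setT
    (fun p : measurableTypeR R * measurableTypeR R => F (ofreim p)).
  by apply: measurableT_comp => //; exact: measurable_ofreim.
rewrite !integral_lebesgue_complex//.
have mG : measurable_fun setT (fun u : R => \int[leb]_v F (Complex u v)).
  exact: (measurable_fun_fubini_tonelli_F (m2 := leb) _ m2).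
rewrite -[RHS](integral_lebesgue_translation a mG) => [|u]; last first.
  by apply: integral_ge0 => v _; exact: F0.
apply: eq_integral => u _.
have mv : measurable_fun setT (fun v : R => F (Complex (u + a)%R v)).
  exact: (measurableT_comp m2 (measurable_pair1 _)).
by rewrite -[RHS](integral_lebesgue_translation b mv).
Qed.

End lebesgue_translation.

Section tuple_integral.
Context d (T : measurableType d) (R : realType).
Variable mu : {sigma_finite_measure set T -> \bar R}.
Local Open Scope ereal_scope.

Lemma integral_tuple_measure0 (F : 0.-tuple T -> \bar R) :
  measurable_fun setT F -> \int[tuple_measure mu 0]_t F t = F [tuple].
Proof.
move=> mF; transitivity (\int[\d_[tuple]]_t F t).
  by apply: eq_measure_integral => A mA _.
by rewrite integral_dirac// diracT mul1e.
Qed.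

Lemma integral_tuple_measureS n (F : n.+1.-tuple T -> \bar R) :
  measurable_fun setT F -> (forall t, 0 <= F t) ->
  \int[tuple_measure mu n.+1]_t F t =
  \int[mu]_x \int[tuple_measure mu n]_t F (tuple_cons (x, t)).
Proof.
move=> mF F0.
pose m := measure_function_pushforward__canonical__measure_function_Measure
  (mu \x tuple_measure mu n) (@measurable_tuple_cons _ T n).
transitivity (\int[m]_t F t); first by apply: eq_measure_integral => A mA _.
have mc := @measurable_tuple_cons _ T n.
rewrite ge0_integral_pushforward// preimage_setT fubini_tonelli1//.
- by apply: measurableT_comp.
- by move=> x; exact: F0.
Qed.

Lemma tnth_tuple_cons0 n (x : T) (t : n.-tuple T) :
  tnth (tuple_cons (x, t)) ord0 = x.
Proof. by rewrite (tnth_nth x). Qed.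

Lemma tnth_tuple_consS n (x : T) (t : n.-tuple T) i :
  tnth (tuple_cons (x, t)) (lift ord0 i) = tnth t i.
Proof. by rewrite !(tnth_nth x). Qed.

Lemma measurable_tuple_prod d' (V : measurableType d') n
    (f : 'I_n -> V -> \bar R) :
  (forall i, measurable_fun setT (f i)) ->
  measurable_fun setT (fun v => \prod_(i < n) f i v).
Proof.
elim: n f => [|n IH] f mf.
  under eq_fun do rewrite big_ord0.
  exact: measurable_cst.
under eq_fun do rewrite big_ord_recl.
by apply: emeasurable_funM => //; apply: IH.
Qed.

Lemma integral_tuple_measure_prod n (f : 'I_n -> T -> \bar R) :
  (forall i, measurable_fun setT (f i)) -> (forall i x, 0 <= f i x) ->
  \int[tuple_measure mu n]_t \prod_(i < n) f i (tnth t i) =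
  \prod_(i < n) \int[mu]_x f i x.
Proof.
have mt m (g : 'I_m -> T -> \bar R) : (forall i, measurable_fun setT (g i)) ->
    measurable_fun setT (fun t : m.-tuple T => \prod_(i < m) g i (tnth t i)).
  move=> mg; apply: measurable_tuple_prod => i.
  by apply: measurableT_comp => //; exact: measurable_tnth.
elim: n f => [|n IH] f mf f0.
  by rewrite integral_tuple_measure0 ?big_ord0//; exact: mt.
rewrite integral_tuple_measureS//; last 2 first.
- exact: mt.
- by move=> t; apply: prode_ge0.
rewrite big_ord_recl -IH//; set I := \int[tuple_measure mu n]_t _.
have I0 : 0 <= I by apply: integral_ge0 => t _; apply: prode_ge0.
rewrite [RHS]muleC -ge0_integralZl//.
apply: eq_integral => x _; rewrite muleC -ge0_integralZl//; last 2 first.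
- exact: (mt _ (fun i => f (lift ord0 i))).
- by move=> t _; apply: prode_ge0.
apply: eq_integral => t _; rewrite big_ord_recl tnth_tuple_cons0; congr (_ * _).
by apply: eq_bigr => i _; rewrite tnth_tuple_consS.
Qed.

End tuple_integral.

Section cvec_translation.
Variable R : realType.
Local Open Scope ereal_scope.

Definition cvec_add M (v c : M.-tuple R[i]) : M.-tuple R[i] :=
  [tuple (tnth v m + tnth c m)%R | m < M].

Lemma measurable_cvec_add M d (T : measurableType d) (v c : T -> M.-tuple R[i]) :
  measurable_fun setT v -> measurable_fun setT c ->
  measurable_fun setT (fun t => cvec_add (v t) (c t)).
Proof.
move=> /measurable_fun_tnthP mv /measurable_fun_tnthP mc.
apply/measurable_fun_tnthP => i.
rewrite (_ : _ \o _ = fun t => (tnth (v t) i + tnth (c t) i)%R).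
  exact: measurable_complexD (mv i) (mc i).
by apply/funext => t; rewrite /= tnth_mktuple.
Qed.

(** The measure is an iterated product, so Tonelli allows one coordinate to be translated at a time:
    the head by the complex case, the tail by induction. *)
Lemma integral_lebesgue_cvec_translation M (c : M.-tuple R[i])
    (F : M.-tuple R[i] -> \bar R) :
  measurable_fun setT F -> (forall v, 0 <= F v) ->
  \int[lebesgue_cvec R M]_v F (cvec_add v c) = \int[lebesgue_cvec R M]_v F v.
Proof.
elim: M c F => [|M IH] c F mF F0.
  by apply: eq_integral => v _; congr F; rewrite [LHS]tuple0 [RHS]tuple0.
have mFc : measurable_fun setT (fun v => F (cvec_add v c)).
  by apply: measurableT_comp => //; exact: measurable_cvec_add.
have mFt (g : R[i] -> R[i]) : measurable_fun setT g -> measurable_fun setT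
    (fun p : R[i] * M.-tuple R[i] => F (tuple_cons (g p.1, p.2))).
  move=> mg; apply: measurableT_comp => //.
  apply: (measurableT_comp (@measurable_tuple_cons _ _ _)).
  by apply: measurable_fun_pair => //; exact: measurableT_comp.
rewrite !integral_tuple_measureS//.
pose G z := \int[lebesgue_cvec R M]_t F (tuple_cons (z, t)).
rewrite -[RHS](@integral_lebesgue_complex_translation _ (thead c) G); last 2 first.
- exact: (measurable_fun_fubini_tonelli_F (m2 := lebesgue_cvec R M) _
    (mFt _ (@measurable_id _ _ _)) (fun=> F0 _)).
- by move=> z; apply: integral_ge0.
apply: eq_integral => z _.
pose c' : M.-tuple R[i] := [tuple of behead c].
rewrite /G -(IH c' (fun t => F (tuple_cons ((z + thead c)%R, t)))) => [|//|//].
  apply: eq_integral => t _; congr F; apply: eq_from_tnth => i.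
  rewrite tnth_mktuple; case: (unliftP ord0 i) => [j ->|->].
    rewrite !tnth_tuple_consS tnth_mktuple tnth_behead.
    congr (_ + tnth _ _)%R; apply: val_inj.
    by rewrite /= inordK ?ltnS.
  by rewrite !tnth_tuple_cons0.
exact: (measurableT_comp (mFt _ (@measurable_id _ _ _)) (measurable_pair1 _)).
Qed.

End cvec_translation.

(** * Independence and product laws *)

Section independence.
Context d (T : measurableType d) (R : realType) (P : probability T R).

Definition independent_pair d1 (U : measurableType d1) d2 (V : measurableType d2)
    (X : T -> U) (Y : T -> V) :=
  forall A B, measurable A -> measurable B ->
    P (X @^-1` A `&` Y @^-1` B) = (P (X @^-1` A) * P (Y @^-1` B))%E.

Lemma measurable_preimageT d1 (U : measurableType d1) (X : T -> U) A :
  measurable_fun setT X -> measurable A -> measurable (X @^-1` A).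
Proof. by move=> mX mA; rewrite -[X in measurable X]setTI; exact: mX. Qed.

(** With [C] fixed, both sides are finite measures in [A]: the law of X under P restricted to C, and
    P C times the law of X. Agreement on a generating pi-system forces equality. *)
Lemma independent_generated d1 (U : measurableType d1) (X : T -> U)
    (G : set (set U)) (C : set T) :
  measurable_fun setT X -> measurable = <<s G >> -> setI_closed G -> G setT ->
  measurable C ->
  (forall A, G A -> P (X @^-1` A `&` C) = (P (X @^-1` A) * P C)%E) ->
  forall A, measurable A -> P (X @^-1` A `&` C) = (P (X @^-1` A) * P C)%E.
Proof.
move=> mX mG GI GT mC XC A mA.
pose m1 := measure_function_pushforward__canonical__measure_function_Measure
  (mrestr P mC) mX.
pose mP := measure_function_pushforward__canonical__measure_function_Measure P mX.
have PC0 : 0 <= fine (P C) by exact: fine_ge0.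
pose m2 := mscale (NngNum PC0) mP.
have PCE : (fine (P C))%:E = P C by rewrite fineK// fin_num_measure.
suff : m1 A = m2 A.
  by rewrite /m1 /m2 /= /mscale/= /pushforward /mrestr PCE muleC.
apply: (measure_unique G (fun=> setT)) => //.
- by apply/seteqP; split => // x _; exists 0%N.
- move=> B GB; rewrite /m1 /m2 /= /mscale/= /pushforward /mrestr PCE muleC.
  exact: XC.
- move=> _; rewrite /m1/= /pushforward /mrestr.
  apply: (@le_lt_trans _ _ 1%E); last exact: ltry.
  apply: probability_le1; apply: measurableI => //.
  exact: measurable_preimageT.
Qed.

(** The joint law agrees with the product of the two laws on rectangles, hence everywhere, and
    Tonelli applies. Both integrals are pulled back to P, so two independent copies of the sample
    point appear. *)
Lemma integral_independent_pair d1 (U : measurableType d1)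
    d2 (V : measurableType d2) (X : T -> U) (Y : T -> V) (F : U * V -> \bar R) :
  measurable_fun setT X -> measurable_fun setT Y -> independent_pair X Y ->
  measurable_fun setT F -> (forall u, 0 <= F u)%E ->
  (\int[P]_t F (X t, Y t) = \int[P]_t' \int[P]_t F (X t, Y t'))%E.
Proof.
move=> mX mY XY mF F0.
have mXY : measurable_fun setT (fun t => (X t, Y t)) by exact: measurable_fun_pair.
pose X' : {RV P >-> U} := HB.pack X (isMeasurableFun.Build _ _ _ _ _ mX).
pose Y' : {RV P >-> V} := HB.pack Y (isMeasurableFun.Build _ _ _ _ _ mY).
pose pX := distribution P X'.
pose pY := distribution P Y'.
pose pXY := measure_function_pushforward__canonical__measure_function_Measure P mXY.
transitivity (\int[pXY]_u F u)%E.
  by rewrite ge0_integral_pushforward// preimage_setT.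
transitivity (\int[(pX \x pY)%E]_u F u)%E.
  apply: eq_measure_integral => A mA _; apply/esym.
  by apply: (product_measure_unique (m1 := pX) (m2 := pY) (m' := pXY)).
rewrite fubini_tonelli2//.
rewrite (ge0_integral_pushforward mY)//; last 2 first.
- exact: (measurable_fun_fubini_tonelli_G (m1 := pX)).
- by move=> y _; apply: integral_ge0.
rewrite preimage_setT; apply: eq_integral => t _ /=.
rewrite /fubini_G (ge0_integral_pushforward mX)// ?preimage_setT//.
exact: (measurableT_comp mF (measurable_pair2 _)).
Qed.

Section box.
Context d1 (U : measurableType d1).

Definition box n (B : 'I_n -> set U) : set (n.-tuple U) :=
  [set t | forall i, B i (tnth t i)].

Definition boxes n : set (set (n.-tuple U)) :=
  [set box B | B in [set B | forall i, measurable (B i)]].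

Lemma boxesI n : setI_closed (@boxes n).
Proof.
move=> _ _ [B mB <-] [C mC <-]; exists (fun i => B i `&` C i).
  by move=> i; exact: measurableI.
by apply/seteqP; split => t /= => [h|[h1 h2] i]; split => // i; case: (h i).
Qed.

Lemma boxT n : box (fun=> setT) = [set: n.-tuple U].
Proof. by apply/seteqP; split. Qed.

Lemma boxesT n : @boxes n setT.
Proof. by exists (fun=> setT) => //; exact: boxT. Qed.

Lemma measurable_boxes n : measurable = <<s @boxes n >>.
Proof.
apply/seteqP; split.
  apply: smallest_sub; first exact: smallest_sigma_algebra.
  rewrite -bigcup_seq => A [i _ [B mB <-]].
  (* A cylinder is a box with all its other sides full. *)
  apply: sub_sigma_algebra; exists (fun j => if j == i then B else setT).
    by move=> j; case: ifPn.
  apply/seteqP; split => t /=.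
    by move=> /(_ i); rewrite eqxx; split.
  by move=> [_ Bt] j; case: ifPn => // /eqP ->.
apply: smallest_sub; first exact: sigma_algebra_measurable.
move=> _ [B mB <-].
rewrite (_ : box B = \bigcap_(i in [set: 'I_n]) ((@tnth _ _)^~ i @^-1` B i)).
  apply: fin_bigcap_measurable => // i _.
  by rewrite -[X in measurable X]setTI; apply: measurable_tnth.
by apply/seteqP; split => t /= h i; [move=> _|]; exact: h.
Qed.

Definition tuple_of_family n (X : 'I_n -> T -> U) (t : T) : n.-tuple U :=
  [tuple X i t | i < n].

Lemma measurable_tuple_of_family n (X : 'I_n -> T -> U) :
  (forall i, measurable_fun setT (X i)) ->
  measurable_fun setT (tuple_of_family X).
Proof.
move=> mX; apply/measurable_fun_tnthP => i.
rewrite (_ : _ \o _ = X i)//.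
by apply/funext => t; rewrite /= tnth_mktuple.
Qed.

(** Subfamilies are covered by taking some of the [B i] to be the whole space. *)
Definition independent_family n (X : 'I_n -> T -> U) :=
  forall B, (forall i, measurable (B i)) ->
  P (tuple_of_family X @^-1` box B) = (\prod_(i < n) P (X i @^-1` B i))%E.

(** Prepares inductions on n. The head is independent of the tail on boxes by assumption, and the
    pi-system argument extends this to all measurable events of the tail. *)
Lemma independent_familyS n (X : 'I_n.+1 -> T -> U) :
  (forall i, measurable_fun setT (X i)) -> independent_family X ->
  independent_family (fun i => X (lift ord0 i)) /\
  independent_pair (X ord0) (tuple_of_family (fun i => X (lift ord0 i))).
Proof.
move=> mX iX.
have iX' : forall A B, measurable A -> (forall i, measurable (B i)) ->
  P (X ord0 @^-1` A `&` tuple_of_family (fun i => X (lift ord0 i)) @^-1` box B) =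
  (P (X ord0 @^-1` A) * \prod_(i < n) P (X (lift ord0 i) @^-1` B i))%E.
  move=> A B mA mB.
  pose C i := if unlift ord0 i is Some j then B j else A.
  have mC i : measurable (C i) by rewrite /C; case: unlift.
  have := iX C mC; rewrite big_ord_recl /C unlift_none.
  under eq_bigr do rewrite liftK.
  move=> <-; congr (P _); apply/seteqP; split => t /=.
    move=> [At Bt] i; rewrite tnth_mktuple; case: (unliftP ord0 i) => [j ->|->//].
    by have := Bt j; rewrite tnth_mktuple.
  move=> h; split; first by have := h ord0; rewrite tnth_mktuple unlift_none.
  by move=> j; have := h (lift ord0 j); rewrite !tnth_mktuple liftK.
have iF : independent_family (fun i => X (lift ord0 i)).
  move=> B mB; have := iX' setT B measurableT mB.
  by rewrite preimage_setT setTI probability_setT mul1e.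
split=> // A B mA mB; rewrite setIC muleC.
have mt := @measurable_tuple_of_family _ _ (fun i => mX (lift ord0 i)).
apply: (independent_generated mt (@measurable_boxes n) (@boxesI n) (@boxesT n))
  => //; first exact: measurable_preimageT.
move=> _ [C mC <-]; rewrite setIC muleC iX'//.
by rewrite -iF.
Qed.

Lemma integral_independent_family n (X : 'I_n -> T -> U) (f : 'I_n -> U -> \bar R) :
  (forall i, measurable_fun setT (X i)) -> independent_family X ->
  (forall i, measurable_fun setT (f i)) -> (forall i u, 0 <= f i u)%E ->
  (\int[P]_t \prod_(i < n) f i (X i t) = \prod_(i < n) \int[P]_t f i (X i t))%E.
Proof.
elim: n X f => [|n IH] X f mX iX mf f0.
  rewrite big_ord0; under eq_integral do rewrite big_ord0.
  by rewrite integral_cst// mul1e; exact: probability_setT.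
have [iX' X0] := independent_familyS mX iX.
have mY := @measurable_tuple_of_family _ _ (fun i => mX (lift ord0 i)).
pose F (p : U * n.-tuple U) :=
  (f ord0 p.1 * \prod_(i < n) f (lift ord0 i) (tnth p.2 i))%E.
have mF : measurable_fun setT F.
  apply: emeasurable_funM; first exact: measurableT_comp.
  apply: measurable_tuple_prod => i; apply: measurableT_comp => //.
  exact: (measurableT_comp (measurable_tnth i) measurable_snd).
have F0 p : (0 <= F p)%E by rewrite mule_ge0// prode_ge0.
under eq_integral do rewrite big_ord_recl.
transitivity (\int[P]_t
    F (X ord0 t, tuple_of_family (fun i => X (lift ord0 i)) t))%E.
  apply: eq_integral => t _; rewrite /F/=; congr (_ * _)%E.
  by apply: eq_bigr => i _; rewrite tnth_mktuple.
rewrite (integral_independent_pair _ mY X0)// big_ord_recl.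
rewrite -(IH _ _ (fun i => mX (lift ord0 i)) iX' (fun i => mf (lift ord0 i))
  (fun i => f0 (lift ord0 i))).
rewrite -ge0_integralZl//; last 3 first.
- apply: measurable_tuple_prod => i; exact: measurableT_comp.
- by move=> t _; apply: prode_ge0.
- by apply: integral_ge0.
apply: eq_integral => t _; rewrite muleC /F/= -ge0_integralZl//; last 2 first.
- exact: measurableT_comp.
- by apply: prode_ge0.
apply: eq_integral => t' _; rewrite muleC; congr (_ * _)%E.
by apply: eq_bigr => i _; rewrite tnth_mktuple.
Qed.

End box.

(** This is where the antennas decouple. The family Y is frozen first, the inner integral over X
    factors, and each factor is then a function of a single Y_i, so the outer integral factors
    too. *)
Lemma integral_independent_families d1 (U : measurableType d1)
    d2 (V : measurableType d2) n (X : 'I_n -> T -> U) (Y : 'I_n -> T -> V)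
    (f : 'I_n -> U * V -> \bar R) :
  (forall i, measurable_fun setT (X i)) -> (forall i, measurable_fun setT (Y i)) ->
  independent_family X -> independent_family Y ->
  independent_pair (tuple_of_family X) (tuple_of_family Y) ->
  (forall i, measurable_fun setT (f i)) -> (forall i u, 0 <= f i u)%E ->
  (\int[P]_t \prod_(i < n) f i (X i t, Y i t) =
   \prod_(i < n) \int[P]_t' \int[P]_t f i (X i t, Y i t'))%E.
Proof.
move=> mX mY iX iY XY mf f0.
have mXt := measurable_tuple_of_family mX.
have mYt := measurable_tuple_of_family mY.
pose F (p : n.-tuple U * n.-tuple V) := (\prod_(i < n) f i (tnth p.1 i, tnth p.2 i))%E.
have mF : measurable_fun setT F.
  apply: measurable_tuple_prod => i; apply: measurableT_comp => //.
  apply: measurable_fun_pair.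
    exact: (measurableT_comp (measurable_tnth i) measurable_fst).
  exact: (measurableT_comp (measurable_tnth i) measurable_snd).
have F0 p : (0 <= F p)%E by exact: prode_ge0.
transitivity (\int[P]_t F (tuple_of_family X t, tuple_of_family Y t))%E.
  by apply: eq_integral => t _; apply: eq_bigr => i _; rewrite !tnth_mktuple.
rewrite (integral_independent_pair mXt mYt XY)//.
have mfp i : measurable_fun setT (fun v => \int[P]_t f i (X i t, v))%E.
  apply: (measurable_fun_fubini_tonelli_G (m1 := P) (fun p => f i (X i p.1, p.2))) => //.
  apply: measurableT_comp => //; apply: measurable_fun_pair => //.
  exact: measurableT_comp.
rewrite -(integral_independent_family mY iY mfp); last first.
  by move=> i v; exact: integral_ge0.
apply: eq_integral => t _.
rewrite -(integral_independent_family (f := fun i u => f i (u, Y i t)) mX iX)//.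
  by apply: eq_integral => t' _; apply: eq_bigr => i _; rewrite !tnth_mktuple.
by move=> i; exact: (measurableT_comp (mf i) (measurable_pair2 _)).
Qed.

End independence.

(** * Densities of transformed variables *)

Section transformed_density.
Context d (T : measurableType d) (R : realType) (P : probability T R).
Context dU (U : measurableType dU).
Variable lam : {sigma_finite_measure set U -> \bar R}.

(* Given X = v, the variable tau v W has density g o (sigma v) because tau v
   is a lam-preserving bijection with inverse sigma v; f averages over X. *)
Lemma has_density_transform dV (V : measurableType dV) (tau sigma : V -> U -> U)
    (X : T -> V) (W : T -> U) (g f : U -> R) :
  measurable_fun setT (fun p : V * U => tau p.1 p.2) ->
  measurable_fun setT (fun p : V * U => sigma p.1 p.2) ->
  (forall v u, sigma v (tau v u) = u) ->
  (forall v (F : U -> \bar R), measurable_fun setT F -> (forall u, 0 <= F u)%E ->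
    (\int[lam]_u F (tau v u) = \int[lam]_u F u)%E) ->
  measurable_fun setT X -> has_density P lam W g -> independent_pair P W X ->
  (forall u, (f u)%:E = \int[P]_t (g (sigma (X t) u))%:E)%E ->
  has_density P lam (fun t => tau (X t) (W t)) f.
Proof.
move=> mtau msig sigK tauI mX Wg WX fE; have [mW mg g0 _] := Wg.
have mgs : measurable_fun setT (fun p : T * U => (g (sigma (X p.1) p.2))%:E).
  apply/measurable_EFinP; apply: measurableT_comp => //.
  have mp : measurable_fun setT (fun p : T * U => (X p.1, p.2)).
    by apply: measurable_fun_pair => //; exact: measurableT_comp.
  exact: (measurableT_comp msig mp).
have gs0 (p : T * U) : (0 <= (g (sigma (X p.1) p.2))%:E)%E by rewrite lee_fin.
(* The equation [fE] exhibits [f] as a parameter integral of a jointly measurable function. *)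
have mf : measurable_fun setT f.
  apply/measurable_EFinP; rewrite (_ : _ \o _ = fun u =>
    \int[P]_t (g (sigma (X t) u))%:E)%E; last exact/funext/fE.
  exact: (measurable_fun_fubini_tonelli_G (m1 := P) _ mgs gs0).
have f0 u : 0 <= f u by rewrite -lee_fin fE integral_ge0// => t _; rewrite lee_fin.
have mO : measurable_fun setT (fun t => tau (X t) (W t)).
  exact: (measurableT_comp mtau (measurable_fun_pair mX mW)).
split=> // B mB.
pose I (p : U * V) : \bar R := (\1_B (tau p.2 p.1))%:E.
have mI : measurable_fun setT I.
  apply/measurable_EFinP; apply: measurableT_comp; first exact: measurable_indic.
  have mp : measurable_fun setT (fun p : U * V => (p.2, p.1)).
    exact: measurable_fun_pair.
  exact: (measurableT_comp mtau mp).
have I0 p : (0 <= I p)%E by rewrite lee_fin.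
transitivity (\int[P]_t I (W t, X t))%E.
  rewrite [RHS](_ : _ = \int[P]_t (\1_((fun t => tau (X t) (W t)) @^-1` B) t)%:E)%E//.
  by rewrite integral_indic ?setIT//; exact: measurable_preimageT.
rewrite (integral_independent_pair mW mX WX mI I0).
transitivity (\int[P]_t \int[lam]_u ((\1_B u)%:E * (g (sigma (X t) u))%:E))%E.
  apply: eq_integral => t _.
  rewrite (has_density_integral Wg (F := fun u => I (u, X t)))//; last first.
    exact: (measurableT_comp mI (measurable_pair2 _)).
  (* The change of variables is read backwards: it frees the indicator from [tau] and puts [sigma]
     inside [g]. Exchanging the integrals afterwards produces the average that defines [f]. *)
  rewrite -(tauI (X t) (fun u => (\1_B u)%:E * (g (sigma (X t) u))%:E)%E).
  - by apply: eq_integral => u _; rewrite sigK.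
  - apply: emeasurable_funM; first exact/measurable_EFinP/measurable_indic.
    exact: (measurableT_comp mgs (measurable_pair1 _)).
  - by move=> u; rewrite mule_ge0 ?lee_fin.
rewrite (fubini_tonelli (m1 := P) (m2 := lam)
  (fun p => (\1_B p.2)%:E * (g (sigma (X p.1) p.2))%:E)%E); first last.
- by move=> p; rewrite mule_ge0 ?lee_fin.
- apply: emeasurable_funM => //; apply/measurable_EFinP.
  by apply: measurableT_comp => //; exact: measurable_indic.
rewrite [RHS]integral_mkcond; apply: eq_integral => u _ /=.
rewrite ge0_integralZl ?lee_fin//; last 2 first.
- exact: (measurableT_comp mgs (measurable_pair2 _)).
- by move=> t _; rewrite lee_fin.
by rewrite -fE patchE indicE; case: ifPn => _; rewrite ?mul1e ?mul0e.
Qed.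

(** Since [X] and [S] are independent, integrating over [X] first leaves the symbol frozen at [s],
    where the density of [H (s, X)] is known; the outer integral is then against the law of [S]. *)
Lemma has_conditional_density_of dS (V : measurableType dS) dZ
    (Z : measurableType dZ) (S : {RV P >-> V}) (X : T -> Z) (H : V * Z -> U)
    (f : V -> U -> R) :
  measurable_fun setT X -> measurable_fun setT H -> independent_pair P X S ->
  measurable_fun setT (fun su : V * U => f su.1 su.2) ->
  (forall s, has_density P lam (fun t => H (s, X t)) (f s)) ->
  has_conditional_density lam S (fun t => H (S t, X t)) f.
Proof.
move=> mX mH XS mf fH.
have mS : measurable_fun setT S by [].
have mHX : measurable_fun setT (fun t => H (S t, X t)).
  by apply: measurableT_comp => //; exact: measurable_fun_pair.
split=> //; first by move=> s u; have [_ _ ->] := fH s.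
move=> A B mA mB.
pose I (p : Z * V) : \bar R := ((\1_A p.2)%:E * (\1_B (H (p.2, p.1)))%:E)%E.
have mI : measurable_fun setT I.
  apply: emeasurable_funM; apply/measurable_EFinP; apply: measurableT_comp => //;
    try exact: measurable_indic.
  by apply: measurableT_comp => //; exact: measurable_fun_pair.
have I0 p : (0 <= I p)%E by rewrite mule_ge0 ?lee_fin.
transitivity (\int[P]_t I (X t, S t))%E.
  rewrite (_ : (fun t => _) = (fun t =>
    (\1_(S @^-1` A `&` (fun t => H (S t, X t)) @^-1` B) t)%:E)); last first.
    by apply/funext => t; rewrite /I indicI.
  rewrite integral_indic ?setIT//; apply: measurableI.
    exact: measurable_preimageT.
  exact: measurable_preimageT.
rewrite (integral_independent_pair mX mS XS mI I0).
transitivity (\int[P]_t' ((fun s => \int[lam]_(u in B) (f s u)%:E) \_ A (S t')))%E.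
  apply: eq_integral => t _; rewrite patchE.
  have [_ _ _ fB] := fH (S t).
  rewrite -fB// /I/= ge0_integralZl ?lee_fin//; last first.
    apply/measurable_EFinP; apply: measurableT_comp; first exact: measurable_indic.
    by apply: measurableT_comp => //; exact: measurable_fun_pair.
  rewrite -[X in (_ * X)%E](_ : (\int[P]_t0
      (\1_((fun t0 => H (S t, X t0)) @^-1` B) t0)%:E)%E = _)//.
  rewrite integral_indic ?setIT//; last first.
    apply: measurable_preimageT => //; apply: measurableT_comp => //.
    exact: measurable_fun_pair.
  by rewrite indicE; case: ifPn => _; rewrite ?mul1e ?mul0e.
have mfB : measurable_fun setT (fun s => \int[lam]_(u in B) (f s u)%:E)%E.
  rewrite (_ : (fun s => _) = fun s =>
      \int[lam]_u ((f s u)%:E * (\1_B u)%:E))%E; last first.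
    apply/funext => s; rewrite integral_mkcond; apply: eq_integral => u _.
    by rewrite patchE indicE; case: ifPn => _; rewrite ?mule1 ?mule0.
  apply: (measurable_fun_fubini_tonelli_F (m2 := lam)
    (fun p : V * U => (f p.1 p.2)%:E * (\1_B p.2)%:E)%E).
    apply: emeasurable_funM; first exact/measurable_EFinP.
    have mi : measurable_fun setT (\1_B : U -> R) by exact: measurable_indic.
    apply/measurable_EFinP; exact: (measurableT_comp mi measurable_snd).
  move=> p; have [_ _ f0 _] := fH p.1.
  by rewrite mule_ge0 ?lee_fin.
rewrite [RHS]integral_mkcond ge0_integral_pushforward ?preimage_setT//.
- apply/(measurable_restrictT _ mA); exact: measurable_funTS.
- move=> s _; rewrite patchE; case: ifPn => // _.
  apply: integral_ge0 => u _; have [_ _ f0 _] := fH s.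
  by rewrite lee_fin.
Qed.

End transformed_density.

(** * Independence of grouped variables *)

Section grouping.
Context d (T : measurableType d) (R : realType) (P : probability T R).
Local Open Scope ereal_scope.

(** Rectangles form a pi-system that generates the product sigma-algebra; this joins two variables
    into one. *)
Lemma independent_product d1 (U : measurableType d1) d2 (V : measurableType d2)
    (X : T -> U) (Y : T -> V) (C : set T) :
  measurable_fun setT X -> measurable_fun setT Y -> measurable C ->
  (forall A B, measurable A -> measurable B ->
    P ((X @^-1` A `&` Y @^-1` B) `&` C) = P (X @^-1` A `&` Y @^-1` B) * P C) ->
  forall D, measurable D ->
    P ((fun t => (X t, Y t)) @^-1` D `&` C) =
    P ((fun t => (X t, Y t)) @^-1` D) * P C.
Proof.
move=> mX mY mC XYC.
apply: (independent_generated
  (G := [set A `*` B | A in measurable & B in measurable])) => //.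
- exact: measurable_fun_pair.
- exact: measurable_prod_measurableType.
- move=> _ _ [A1 mA1 [B1 mB1 <-]] [A2 mA2 [B2 mB2 <-]].
  exists (A1 `&` A2); first exact: measurableI.
  by exists (B1 `&` B2); [exact: measurableI|rewrite setXI].
- by exists setT => //; exists setT => //; rewrite setXTT.
- by move=> _ [A mA [B mB <-]]; exact: XYC.
Qed.

Section five.
Context d1 (U : measurableType d1) d2 (V : measurableType d2)
  d3 (W : measurableType d3) d4 (Z : measurableType d4) d5 (S' : measurableType d5).
Variables (n : nat) (X : 'I_n -> T -> U) (Y : 'I_n -> T -> V).
Variables (w : T -> W) (z : T -> Z) (S : T -> S').
Hypotheses (mX : forall i, measurable_fun setT (X i))
  (mY : forall i, measurable_fun setT (Y i)).
Hypotheses (mw : measurable_fun setT w) (mz : measurable_fun setT z)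
  (mS : measurable_fun setT S).
Let Xt := tuple_of_family X.
Let Yt := tuple_of_family Y.
Let mXt : measurable_fun setT Xt := measurable_tuple_of_family mX.
Let mYt : measurable_fun setT Yt := measurable_tuple_of_family mY.

Hypothesis ind : forall A B C1 C2 C3,
  (forall i, measurable (A i)) -> (forall i, measurable (B i)) ->
  measurable C1 -> measurable C2 -> measurable C3 ->
  P (Xt @^-1` box A `&` (Yt @^-1` box B `&`
    (w @^-1` C1 `&` (z @^-1` C2 `&` S @^-1` C3)))) =
  \prod_(i < n) P (X i @^-1` A i) * (\prod_(i < n) P (Y i @^-1` B i) *
    (P (w @^-1` C1) * (P (z @^-1` C2) * P (S @^-1` C3)))).

Let prodT dK (K : measurableType dK) (G : 'I_n -> T -> K) :
  \prod_(i < n) P (G i @^-1` setT) = 1.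
Proof.
by rewrite big1// => i _; rewrite preimage_setT probability_setT.
Qed.

Let mT dK (K : measurableType dK) :
  forall i : 'I_n, measurable ((fun=> [set: K]) i).
Proof. by move=> i; exact: measurableT. Qed.

Let PT : P setT = 1. Proof. exact: probability_setT. Qed.

Lemma five_independent_family1 : independent_family P X.
Proof.
move=> A mA.
have := @ind A (fun=> setT) setT setT setT mA (@mT _ _) measurableT
  measurableT measurableT.
by rewrite boxT prodT !preimage_setT !setIT PT !mule1.
Qed.

Lemma five_independent_family2 : independent_family P Y.
Proof.
move=> B mB.
have := @ind (fun=> setT) B setT setT setT (@mT _ _) mB measurableT
  measurableT measurableT.
by rewrite boxT prodT !preimage_setT !setIT setTI PT !mule1 mul1e.
Qed.

Let ind_rest C1 C2 C3 : measurable C1 -> measurable C2 -> measurable C3 ->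
  P (w @^-1` C1 `&` (z @^-1` C2 `&` S @^-1` C3)) =
  P (w @^-1` C1) * (P (z @^-1` C2) * P (S @^-1` C3)).
Proof.
move=> m1 m2 m3.
have := @ind (fun=> setT) (fun=> setT) C1 C2 C3 (@mT _ _)
  (@mT _ _) m1 m2 m3.
by rewrite !boxT !prodT !preimage_setT !setTI !mul1e.
Qed.

Let ind_Yrest B C1 C2 C3 : (forall i, measurable (B i)) ->
  measurable C1 -> measurable C2 -> measurable C3 ->
  P (Yt @^-1` box B `&` (w @^-1` C1 `&` (z @^-1` C2 `&` S @^-1` C3))) =
  P (Yt @^-1` box B) * P (w @^-1` C1 `&` (z @^-1` C2 `&` S @^-1` C3)).
Proof.
move=> mB m1 m2 m3.
have := @ind (fun=> setT) B C1 C2 C3 (@mT _ _) mB m1 m2 m3.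
rewrite boxT prodT preimage_setT setTI mul1e => ->.
by rewrite ind_rest// five_independent_family2.
Qed.

Lemma measurable_box dK (K : measurableType dK) m (B : 'I_m -> set K) :
  (forall i, measurable (B i)) -> measurable (box B).
Proof.
by move=> mB; rewrite measurable_boxes; apply: sub_sigma_algebra; exists B.
Qed.

Let mrest C1 C2 C3 : measurable C1 -> measurable C2 -> measurable C3 ->
  measurable (w @^-1` C1 `&` (z @^-1` C2 `&` S @^-1` C3)).
Proof.
by move=> m1 m2 m3; do 2 (apply: measurableI; first exact: measurable_preimageT);
  exact: measurable_preimageT.
Qed.

(** The hypothesis [ind] speaks of boxes only. They are enlarged to arbitrary events one slot at a
    time, the other four slots forming the fixed event of [independent_generated]. *)
Let ind_X A B C1 C2 C3 : measurable A -> (forall i, measurable (B i)) ->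
  measurable C1 -> measurable C2 -> measurable C3 ->
  P (Xt @^-1` A `&` (Yt @^-1` box B `&`
    (w @^-1` C1 `&` (z @^-1` C2 `&` S @^-1` C3)))) =
  P (Xt @^-1` A) * P (Yt @^-1` box B `&`
    (w @^-1` C1 `&` (z @^-1` C2 `&` S @^-1` C3))).
Proof.
move=> mA mB m1 m2 m3; move: A mA.
apply: (independent_generated mXt (@measurable_boxes _ _ _) (@boxesI _ _ n)
  (@boxesT _ _ n)).
  apply: measurableI; last exact: mrest.
  by apply: measurable_preimageT => //; exact: measurable_box.
move=> _ [A mA <-].
by rewrite ind// five_independent_family1// ind_Yrest// ind_rest//
  five_independent_family2.
Qed.

Let ind_XY A B C1 C2 C3 : measurable A -> measurable B ->
  measurable C1 -> measurable C2 -> measurable C3 ->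
  P (Xt @^-1` A `&` (Yt @^-1` B `&`
    (w @^-1` C1 `&` (z @^-1` C2 `&` S @^-1` C3)))) =
  P (Xt @^-1` A) * (P (Yt @^-1` B) *
    (P (w @^-1` C1) * (P (z @^-1` C2) * P (S @^-1` C3)))).
Proof.
move=> mA mB m1 m2 m3.
have XR : P (Xt @^-1` A `&` (w @^-1` C1 `&` (z @^-1` C2 `&` S @^-1` C3))) =
    P (Xt @^-1` A) * P (w @^-1` C1 `&` (z @^-1` C2 `&` S @^-1` C3)).
  have := @ind_X A (fun=> setT) C1 C2 C3 mA (@mT _ _) m1 m2 m3.
  by rewrite boxT preimage_setT !setTI.
(* The event of Y is brought to the front; the event of X, already arbitrary, now belongs to the
   fixed part. *)
rewrite setICA -ind_rest// muleCA -XR.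
move: B mB.
apply: (independent_generated mYt (@measurable_boxes _ _ _) (@boxesI _ _ n)
  (@boxesT _ _ n)).
  by apply: measurableI; [exact: measurable_preimageT|exact: mrest].
move=> _ [B mB <-].
by rewrite setICA ind_X// XR ind_Yrest// muleCA.
Qed.

Lemma five_independent_XY : independent_pair P Xt Yt.
Proof.
move=> A B mA mB.
have := ind_XY mA mB (@measurableT _ W) (@measurableT _ Z) (@measurableT _ S').
by rewrite !preimage_setT !setIT PT !mule1.
Qed.

Lemma five_independent_wz : independent_pair P w z.
Proof.
move=> A B mA mB.
have := ind_rest mA mB (@measurableT _ S').
by rewrite !preimage_setT !setIT PT !mule1.
Qed.

(** Joins the two noises into one variable; [ind_XYwz] then does the same for the two hidden
    families. *)
Let ind_wz A B C D : measurable A -> measurable B -> measurable C ->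
  measurable D ->
  P ((fun t => (w t, z t)) @^-1` D `&` (Xt @^-1` A `&` (Yt @^-1` B `&` S @^-1` C)))
  = P ((fun t => (w t, z t)) @^-1` D) *
    (P (Xt @^-1` A) * (P (Yt @^-1` B) * P (S @^-1` C))).
Proof.
move=> mA mB mC; move: D.
have E : P (Xt @^-1` A `&` (Yt @^-1` B `&` S @^-1` C)) =
    P (Xt @^-1` A) * (P (Yt @^-1` B) * P (S @^-1` C)).
  have := ind_XY mA mB (@measurableT _ W) (@measurableT _ Z) mC.
  by rewrite !preimage_setT !setTI PT !mul1e.
rewrite -E; apply: independent_product => //.
  by do 2 (apply: measurableI; first exact: measurable_preimageT);
    exact: measurable_preimageT.
move=> C1 C2 m1 m2; rewrite E five_independent_wz//.
have -> : (w @^-1` C1 `&` z @^-1` C2) `&`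
    (Xt @^-1` A `&` (Yt @^-1` B `&` S @^-1` C)) =
    Xt @^-1` A `&` (Yt @^-1` B `&`
    (w @^-1` C1 `&` (z @^-1` C2 `&` S @^-1` C))).
  by apply/seteqP; split => t /= -[]; tauto.
rewrite ind_XY// [RHS]muleC -!muleA; congr (_ * (_ * _)).
by rewrite muleA muleC.
Qed.

Let ind_XYwz C D E : measurable C -> measurable D -> measurable E ->
  P ((fun t => (Xt t, Yt t)) @^-1` E `&`
    ((fun t => (w t, z t)) @^-1` D `&` S @^-1` C)) =
  P ((fun t => (Xt t, Yt t)) @^-1` E) *
    (P ((fun t => (w t, z t)) @^-1` D) * P (S @^-1` C)).
Proof.
move=> mC mD; move: E.
have mwz : measurable_fun setT (fun t => (w t, z t)) by exact: measurable_fun_pair.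
have K : P ((fun t => (w t, z t)) @^-1` D `&` S @^-1` C) =
    P ((fun t => (w t, z t)) @^-1` D) * P (S @^-1` C).
  have := ind_wz (@measurableT _ _) (@measurableT _ _) mC mD.
  by rewrite !preimage_setT !setTI PT !mul1e.
rewrite -K; apply: independent_product => //.
  by apply: measurableI; exact: measurable_preimageT.
move=> A B mA mB; rewrite K five_independent_XY//.
have -> : (Xt @^-1` A `&` Yt @^-1` B) `&`
    ((fun t => (w t, z t)) @^-1` D `&` S @^-1` C) =
    (fun t => (w t, z t)) @^-1` D `&`
    (Xt @^-1` A `&` (Yt @^-1` B `&` S @^-1` C)).
  by apply/seteqP; split => t /= -[]; tauto.
by rewrite ind_wz// muleCA -!muleA; congr (_ * _); rewrite muleCA.
Qed.

Lemma five_independent_wz_XY :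
  independent_pair P (fun t => (w t, z t)) (fun t => (Xt t, Yt t)).
Proof.
move=> A B mA mB; rewrite setIC muleC.
have := ind_XYwz (@measurableT _ _) mA mB.
by rewrite preimage_setT setIT PT mule1.
Qed.

Lemma five_independent_XYwz_S :
  independent_pair P (fun t => ((Xt t, Yt t), (w t, z t))) S.
Proof.
move=> D C mD mC; move: D mD.
have mwz : measurable_fun setT (fun t => (w t, z t)) by exact: measurable_fun_pair.
have mXY : measurable_fun setT (fun t => (Xt t, Yt t)).
  exact: measurable_fun_pair.
apply: independent_product => //; first exact: measurable_preimageT.
move=> A B mA mB; rewrite -setIA ind_XYwz// muleA; congr (_ * _).
have := ind_XYwz (@measurableT _ _) mB mA.
by rewrite preimage_setT setIT PT mule1.
Qed.

End five.
End grouping.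

Lemma has_density_pair d (T : measurableType d) (R : realType)
    (P : probability T R) dU (U : measurableType dU) dV (V : measurableType dV)
    (m1 : {sigma_finite_measure set U -> \bar R})
    (m2 : {sigma_finite_measure set V -> \bar R})
    (X : T -> U) (Y : T -> V) (f : U -> R) (g : V -> R) :
  has_density P m1 X f -> has_density P m2 Y g -> independent_pair P X Y ->
  has_density P (m1 \x m2)%E (fun t => (X t, Y t)) (fun p => f p.1 * g p.2).
Proof.
move=> Xf Yg XY; have [mX mf f0 _] := Xf; have [mY mg g0 _] := Yg.
have mXY : measurable_fun setT (fun t => (X t, Y t)) by exact: measurable_fun_pair.
have mfg : measurable_fun setT (fun p : U * V => f p.1 * g p.2).
  by apply: measurable_funM; exact: measurableT_comp.
split=> // [p|B mB]; first by rewrite mulr_ge0.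
have mi : measurable_fun setT (fun p : U * V => (\1_B p)%:E : \bar R).
  by apply/measurable_EFinP; exact: measurable_indic.
have i0 p : (0 <= (\1_B p)%:E :> \bar R)%E by rewrite lee_fin.
transitivity (\int[P]_t (\1_B (X t, Y t))%:E)%E.
  rewrite [RHS](_ : _ = \int[P]_t (\1_((fun t => (X t, Y t)) @^-1` B) t)%:E)%E//.
  by rewrite integral_indic ?setIT//; exact: measurable_preimageT.
rewrite (integral_independent_pair mX mY XY mi i0).
rewrite [RHS]integral_mkcond.
transitivity (\int[m1 \x m2]_p ((\1_B p)%:E * (f p.1)%:E * (g p.2)%:E))%E; last first.
  apply: eq_integral => p _; rewrite patchE indicE.
  by case: ifPn => _; rewrite ?mul1e ?mul0e// EFinM.
rewrite fubini_tonelli2//=; last 2 first.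
- apply: emeasurable_funM; last by apply/measurable_EFinP; exact: measurableT_comp.
  by apply: emeasurable_funM => //; apply/measurable_EFinP; exact: measurableT_comp.
- by move=> p; rewrite !mule_ge0 ?lee_fin.
have m1i : measurable_fun setT (fun v : V => \int[m1]_u ((\1_B (u, v))%:E * (f u)%:E))%E.
  apply: (measurable_fun_fubini_tonelli_G (m1 := m1)
    (fun p => (\1_B p)%:E * (f p.1)%:E)%E).
    by apply: emeasurable_funM => //; apply/measurable_EFinP; exact: measurableT_comp.
  by move=> p; rewrite mule_ge0 ?lee_fin.
transitivity (\int[P]_t (\int[m1]_u ((\1_B (u, Y t))%:E * (f u)%:E)))%E.
  apply: eq_integral => t _.
  rewrite (has_density_integral Xf (F := fun u => (\1_B (u, Y t))%:E))//.
  exact: (measurableT_comp mi (measurable_pair2 _)).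
rewrite (has_density_integral Yg (F := fun v =>
  \int[m1]_u ((\1_B (u, v))%:E * (f u)%:E))%E)//; last first.
  by move=> v; apply: integral_ge0 => u _; rewrite mule_ge0 ?lee_fin.
apply: eq_integral => v _; rewrite /fubini_G/= [LHS]muleC -ge0_integralZl ?lee_fin//.
- by apply: eq_integral => u _; rewrite muleC.
- apply: emeasurable_funM; last exact/measurable_EFinP.
  exact: (measurableT_comp mi (measurable_pair2 _)).
- by move=> u _; rewrite mule_ge0 ?lee_fin.
Qed.

(** * The non-synchronous channels *)

Section nonsynchronous.
Context d (T : measurableType d) (R : realType) (P : probability T R) (M : nat).
Context dU (U : measurableType dU) dV (V : measurableType dV).
Variables (X : 'I_M -> T -> U) (Y : 'I_M -> T -> V).
Variables (w z : {RV P >-> M.-tuple R[i]}) (S : {RV P >-> R[i]}).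
Variables (a : 'I_M -> U -> R[i]) (b : 'I_M -> R[i] -> U * V -> R[i]).
Variable q : 'I_M -> R[i] -> R[i] -> R[i] -> R.
Hypotheses (mX : forall i, measurable_fun setT (X i))
  (mY : forall i, measurable_fun setT (Y i)).
Hypothesis ma : forall m, measurable_fun setT (a m).
Hypothesis mb : forall m,
  measurable_fun setT (fun p : R[i] * (U * V) => b m p.1 p.2).
Hypotheses (gw : standard_gaussian w) (gz : standard_gaussian z).
Hypothesis ind : forall A B C1 C2 C3,
  (forall i, measurable (A i)) -> (forall i, measurable (B i)) ->
  measurable C1 -> measurable C2 -> measurable C3 ->
  P (tuple_of_family X @^-1` box A `&` (tuple_of_family Y @^-1` box B `&`
    (w @^-1` C1 `&` (z @^-1` C2 `&` S @^-1` C3)))) =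
  (\prod_(i < M) P (X i @^-1` A i) * (\prod_(i < M) P (Y i @^-1` B i) *
    (P (w @^-1` C1) * (P (z @^-1` C2) * P (S @^-1` C3)))))%E.
(** The computation specific to a channel enters only here, as the average over the hidden variables
    of one antenna. *)
Hypothesis qE : forall m s x y, (q m s x y)%:E =
  (\int[P]_t' \int[P]_t
    (gauss1 (x - a m (X m t)) * gauss1 (y - b m s (X m t, Y m t')))%:E)%E.

Let output (s : T -> R[i]) (t : T) : M.-tuple R[i] * M.-tuple R[i] :=
  ([tuple a m (X m t) + tnth (w t) m | m < M],
   [tuple b m (s t) (X m t, Y m t) + tnth (z t) m | m < M]).

Let f (s : R[i]) (xy : M.-tuple R[i] * M.-tuple R[i]) : R :=
  \prod_(m < M) q m s (tnth xy.1 m) (tnth xy.2 m).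

Local Notation lam := (lebesgue_cvec R M \x lebesgue_cvec R M)%E.
(* Products of sigma-finite measures have no canonical sigma-finite instance. *)
Let L := sigma_finite_measure_of
  (sigma_finite_product (lebesgue_cvec R M) (lebesgue_cvec R M)).
Let VT := (M.-tuple U * M.-tuple V)%type.
Let mean (s : R[i]) (v : VT) : M.-tuple R[i] * M.-tuple R[i] :=
  ([tuple a m (tnth v.1 m) | m < M],
   [tuple b m s (tnth v.1 m, tnth v.2 m) | m < M]).
Let opp (v : M.-tuple R[i]) : M.-tuple R[i] := [tuple - tnth v m | m < M].
Let tau s (v : VT) (u : M.-tuple R[i] * M.-tuple R[i]) :=
  (cvec_add u.1 (mean s v).1, cvec_add u.2 (mean s v).2).
Let sigma s (v : VT) (u : M.-tuple R[i] * M.-tuple R[i]) :=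
  (cvec_add u.1 (opp (mean s v).1), cvec_add u.2 (opp (mean s v).2)).
Let XY t : VT := (tuple_of_family X t, tuple_of_family Y t).
Let wz t := (w t, z t).
Let g (u : M.-tuple R[i] * M.-tuple R[i]) := gaussian_pdf u.1 * gaussian_pdf u.2.

Let mw : measurable_fun setT w. Proof. by []. Qed.
Let mz : measurable_fun setT z. Proof. by []. Qed.
Let mS : measurable_fun setT S. Proof. by []. Qed.

Let mXY : measurable_fun setT XY.
Proof. by apply: measurable_fun_pair; exact: measurable_tuple_of_family. Qed.

Let mmean : measurable_fun setT (fun p : R[i] * VT => mean p.1 p.2).
Proof.
apply: measurable_fun_pair; apply/measurable_fun_tnthP => m.
  rewrite (_ : _ \o _ = a m \o (fun p : R[i] * VT => tnth p.2.1 m)).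
    apply: measurableT_comp => //.
    exact: (measurableT_comp (measurable_tnth m)
      (measurableT_comp measurable_fst measurable_snd)).
  by apply/funext => p; rewrite /= tnth_mktuple.
rewrite (_ : _ \o _ = (fun p : R[i] * (U * V) => b m p.1 p.2) \o
  (fun p : R[i] * VT => (p.1, (tnth p.2.1 m, tnth p.2.2 m)))).
  apply: measurableT_comp => //; apply: measurable_fun_pair => //.
  apply: measurable_fun_pair.
    exact: (measurableT_comp (measurable_tnth m)
      (measurableT_comp measurable_fst measurable_snd)).
  exact: (measurableT_comp (measurable_tnth m)
    (measurableT_comp measurable_snd measurable_snd)).
by apply/funext => p; rewrite /= tnth_mktuple.
Qed.

Let measurable_opp dK (K : measurableType dK) (h : K -> M.-tuple R[i]) :
  measurable_fun setT h -> measurable_fun setT (fun t => opp (h t)).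
Proof.
move=> /measurable_fun_tnthP mh; apply/measurable_fun_tnthP => i.
rewrite (_ : _ \o _ = fun t => - tnth (h t) i).
  exact: measurable_complexN (mh i).
by apply/funext => t; rewrite /= tnth_mktuple.
Qed.

Let measurable_tau dK (K : measurableType dK) (s : K -> R[i]) (v : K -> VT)
    (u : K -> M.-tuple R[i] * M.-tuple R[i]) :
  measurable_fun setT s -> measurable_fun setT v -> measurable_fun setT u ->
  measurable_fun setT (fun k => tau (s k) (v k) (u k)) /\
  measurable_fun setT (fun k => sigma (s k) (v k) (u k)).
Proof.
move=> ms mv mu.
have msv : measurable_fun setT (fun k => mean (s k) (v k)).
  exact: (measurableT_comp mmean (measurable_fun_pair ms mv)).
have mm1 := measurableT_comp measurable_fst msv.
have mm2 := measurableT_comp measurable_snd msv.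
have mu1 := measurableT_comp measurable_fst mu.
have mu2 := measurableT_comp measurable_snd mu.
split; apply: measurable_fun_pair.
- exact: (measurable_cvec_add mu1 mm1).
- exact: (measurable_cvec_add mu2 mm2).
- exact: (measurable_cvec_add mu1 (measurable_opp mm1)).
- exact: (measurable_cvec_add mu2 (measurable_opp mm2)).
Qed.

Let cvec_addK (u c : M.-tuple R[i]) : cvec_add (cvec_add u c) (opp c) = u.
Proof. by apply: eq_from_tnth => i; rewrite !tnth_mktuple addrK. Qed.

Let tauI s v (F : M.-tuple R[i] * M.-tuple R[i] -> \bar R) :
  measurable_fun setT F -> (forall u, 0 <= F u)%E ->
  (\int[lam]_u F (tau s v u) = \int[lam]_u F u)%E.
Proof.
move=> mF F0.
have mFt : measurable_fun setT (F \o tau s v).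
  apply: measurableT_comp => //.
  by have [] := @measurable_tau _ _ (fun=> s) (fun=> v) id
    (@measurable_cst _ _ _ _ _ _) (@measurable_cst _ _ _ _ _ _) (@measurable_id _ _ _).
transitivity (\int[lebesgue_cvec R M]_x \int[lebesgue_cvec R M]_y
    F (tau s v (x, y)))%E.
  exact: (fubini_tonelli1 (F \o tau s v) mFt (fun=> F0 _)).
transitivity (\int[lebesgue_cvec R M]_x \int[lebesgue_cvec R M]_y F (x, y))%E;
  last by exact: esym (fubini_tonelli1 F mF F0).
have mG : measurable_fun setT (fun x => \int[lebesgue_cvec R M]_y F (x, y))%E.
  exact: (measurable_fun_fubini_tonelli_F (m2 := lebesgue_cvec R M)).
rewrite -[RHS](integral_lebesgue_cvec_translation (mean s v).1 mG); last first.
  by move=> x; apply: integral_ge0.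
apply: eq_integral => x _ /=.
rewrite -[RHS](integral_lebesgue_cvec_translation (mean s v).2
  (F := fun y => F (cvec_add x (mean s v).1, y)))//.
exact: (measurableT_comp mF (measurable_pair1 _)).
Qed.

(** The translated Gaussian density is a product over the antennas, each factor a function of (X_m,
    Y_m) alone, so independence makes its mean the product of the [q m]. *)
Let fE s u : ((f s u)%:E = \int[P]_t (g (sigma s (XY t) u))%:E)%E.
Proof.
pose h m (p : U * V) :=
  gauss1 (tnth u.1 m - a m p.1) * gauss1 (tnth u.2 m - b m s p).
have mh m : measurable_fun setT (h m).
  apply: measurable_funM; apply: measurable_gauss1; apply: measurable_complexD => //;
    apply: measurable_complexN; first exact: measurableT_comp.
  exact: (measurableT_comp (mb m) (measurable_pair1 s)).
rewrite /f -prodEFin.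
under eq_bigr do rewrite qE.
rewrite -(integral_independent_families (f := fun m p => (h m p)%:E) mX mY
  (five_independent_family1 ind) (five_independent_family2 ind)
  (five_independent_XY mX mY mw mz mS ind))//; last 2 first.
- by move=> m; exact/measurable_EFinP.
- by move=> m p; rewrite lee_fin mulr_ge0 ?gauss1_ge0.
apply: eq_integral => t _; rewrite prodEFin; congr EFin.
rewrite /g !gaussian_pdf_prod -big_split/=; apply: eq_bigr => m _.
by rewrite !tnth_mktuple.
Qed.

Let density s : has_density P lam (fun t => tau s (XY t) (wz t)) (f s).
Proof.
have mts : measurable_fun setT
    (fun p : VT * (M.-tuple R[i] * M.-tuple R[i]) => tau s p.1 p.2) /\
  measurable_fun setT
    (fun p : VT * (M.-tuple R[i] * M.-tuple R[i]) => sigma s p.1 p.2).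
  exact: (measurable_tau (@measurable_cst _ _ _ _ _ s)
    (@measurable_fst _ _ VT _) (@measurable_snd _ _ VT _)).
have sK v u : sigma s v (tau s v u) = u.
  by case: u => u1 u2; rewrite /sigma /tau/= !cvec_addK.
have dwz : has_density P lam wz g.
  apply: has_density_pair; [exact: gw|exact: gz|].
  exact: (five_independent_wz ind).
have iwz : independent_pair P wz XY.
  exact: (five_independent_wz_XY mX mY mw mz mS ind).
exact: (@has_density_transform _ _ _ P _ _ L _ _ _ _ _ _ _ _
  mts.1 mts.2 sK (@tauI s) mXY dwz iwz (fE s)).
Qed.

Let outputE (s : T -> R[i]) : output s = fun t => tau (s t) (XY t) (wz t).
Proof.
apply/funext => t; rewrite /output /tau; congr pair; apply: eq_from_tnth => i;
by rewrite !tnth_mktuple addrC.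
Qed.

Lemma nonsynchronous_density s : has_density P lam (output (fun=> s)) (f s).
Proof. by rewrite outputE; exact: density. Qed.

Lemma nonsynchronous_conditional_density :
  has_conditional_density lam S (output S) f.
Proof.
rewrite outputE.
pose H (p : R[i] * (VT * (M.-tuple R[i] * M.-tuple R[i]))) := tau p.1 p.2.1 p.2.2.
apply: (@has_conditional_density_of _ _ _ P _ _ L _ _ _ _ S
  (fun t => (XY t, wz t)) H f).
- apply: measurable_fun_pair => //; exact: measurable_fun_pair.
- have [] // := measurable_tau
   (@measurable_fst _ _ R[i] (VT * (M.-tuple R[i] * M.-tuple R[i]))%type)
   (measurableT_comp measurable_fst measurable_snd)
   (measurableT_comp measurable_snd measurable_snd).
- exact: (five_independent_XYwz_S mX mY mw mz mS ind).
(* Joint measurability in the symbol and the output comes from [fE], which writes the density as a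
   P-integral of a function measurable in all its arguments. *)
- apply/measurable_EFinP.
  rewrite (_ : _ \o _ = fun su : R[i] * (M.-tuple R[i] * M.-tuple R[i]) =>
    \int[P]_t (g (sigma su.1 (XY t) su.2))%:E)%E; last first.
    by apply/funext => su /=; rewrite fE.
  apply: (measurable_fun_fubini_tonelli_F (m2 := P)
    (fun p => (g (sigma p.1.1 (XY p.2) p.1.2))%:E)).
    apply/measurable_EFinP; apply: (measurableT_comp (f := g)).
      have [_ mg _ _] := gw.
      by apply: measurable_funM; exact: measurableT_comp.
    pose E := ((R[i] * (M.-tuple R[i] * M.-tuple R[i])) * T)%type.
    have m11 : measurable_fun setT (fun p : E => p.1.1).
      exact: (measurableT_comp measurable_fst measurable_fst).
    have m12 : measurable_fun setT (fun p : E => p.1.2).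
      exact: (measurableT_comp measurable_snd measurable_fst).
    have m2 : measurable_fun setT (fun p : E => XY p.2).
      exact: (measurableT_comp mXY measurable_snd).
    exact: (measurable_tau m11 m2 m12).2.
  by move=> p; rewrite lee_fin mulr_ge0// gaussian_pdf_prod prodr_ge0// => m _;
    exact: gauss1_ge0.
- exact: density.
Qed.

End nonsynchronous.

(** * Gaussian integrals and the coordinates of a Gaussian vector *)

Section gaussian.
Variable R : realType.
Local Notation leb := (@lebesgue_measure R).

Lemma integral_gaussian (m D : R) : 0 < D ->
  (\int[leb]_u (expR (- (D * (u - m) ^+ 2)))%:E = (Num.sqrt (pi / D))%:E)%E.
Proof.
(* The integrand is the normal density of variance 1 / (2D), up to its peak 1 / sqrt (pi / D). *)
move=> D0; pose s := Num.sqrt (2 * D)^-1.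
have s2 : s ^+ 2 = (2 * D)^-1 by rewrite sqr_sqrtr// invr_ge0 mulr_ge0// ltW.
have s0 : s != 0 by rewrite gt_eqF// sqrtr_gt0 invr_gt0 mulr_gt0.
have D0' : D != 0 by rewrite gt_eqF.
have pk : normal_peak s = (Num.sqrt (pi / D))^-1.
  by rewrite /normal_peak s2; congr (Num.sqrt _)^-1; field.
have pD : 0 < Num.sqrt (pi / D) by rewrite sqrtr_gt0 divr_gt0// pi_gt0.
have fE u : (expR (- (D * (u - m) ^+ 2)))%:E =
    ((Num.sqrt (pi / D))%:E * (normal_pdf m s u)%:E)%E.
  rewrite normal_pdfE// -EFinM pk /normal_fun s2 mulVKf ?gt_eqF//.
  by congr (expR _)%:E; field.
under eq_integral do rewrite fE.
rewrite ge0_integralZl ?lee_fin ?ltW//.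
- by rewrite integral_normal_pdf mule1.
- by apply/measurable_EFinP; exact: measurable_normal_pdf.
- by move=> u _; rewrite lee_fin normal_pdf_ge0.
Qed.

Lemma integral_complex_gaussian (K m1 m2 D : R) : 0 <= K -> 0 < D ->
  (\int[@lebesgue_complex R]_h (K * (expR (- (D * (complex.Re h - m1) ^+ 2)) *
    expR (- (D * (complex.Im h - m2) ^+ 2))))%:E = (K * (pi / D))%:E)%E.
Proof.
move=> K0 D0.
have mE (n : R) : measurable_fun setT (fun u : R => expR (- (D * (u - n) ^+ 2))).
  have mq : measurable_fun setT (fun u : R => D * (u - n) ^+ 2).
    by apply: measurable_funM => //; apply: measurable_funX; exact: measurable_funB.
  apply: (measurableT_comp (f := expR)) => //.
  exact: measurableT_comp mq.
have mEE (n : R) : measurable_fun setT (fun u : measurableTypeR R =>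
    (expR (- (D * (u - n) ^+ 2)))%:E).
  by apply/measurable_EFinP; exact: mE.
have [mr mi] := (measurable_complexP id).1 (@measurable_id _ R[i] setT).
rewrite integral_lebesgue_complex => [||z]; last 2 first.
- apply/measurable_EFinP; apply: measurable_funM => //; apply: measurable_funM.
    exact: (measurableT_comp (mE m1) mr).
  exact: (measurableT_comp (mE m2) mi).
- by rewrite lee_fin !mulr_ge0 ?expR_ge0.
transitivity (\int[leb]_u ((K * Num.sqrt (pi / D))%:E *
    (expR (- (D * (u - m1) ^+ 2)))%:E))%E.
  apply: eq_integral => u _ /=.
  under eq_integral do rewrite mulrA EFinM.
  rewrite ge0_integralZl ?lee_fin ?mulr_ge0 ?expR_ge0//.
  by rewrite integral_gaussian// -!EFinM; congr EFin; ring.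
rewrite ge0_integralZl ?lee_fin ?mulr_ge0 ?sqrtr_ge0//.
rewrite integral_gaussian// -EFinM; congr EFin.
by rewrite -mulrA -expr2 sqr_sqrtr// divr_ge0 ?pi_ge0// ltW.
Qed.

Lemma integral_gauss1 : (\int[@lebesgue_complex R]_h (gauss1 h)%:E = 1)%E.
Proof.
have -> : 1%E = (pi^-1 * (pi / 1) : R)%:E.
  by rewrite divr1 mulVf// gt_eqF// pi_gt0.
rewrite -(@integral_complex_gaussian pi^-1 0 0 1)// ?invr_ge0 ?pi_ge0//.
apply: eq_integral => h _; rewrite /gauss1 cmod_sqr !subr0 !mul1r.
by rewrite -expRD opprD.
Qed.

End gaussian.

Section gaussian_family.
Context d (T : measurableType d) (R : realType) (P : probability T R) (M : nat).
Variable h : {RV P >-> M.-tuple R[i]}.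
Hypothesis gh : standard_gaussian h.
Local Open Scope ereal_scope.

Lemma integral_standard_gaussian (f : 'I_M -> R[i] -> \bar R) :
  (forall i, measurable_fun setT (f i)) -> (forall i u, 0 <= f i u) ->
  \int[P]_t \prod_(i < M) f i (tnth (h t) i) =
  \prod_(i < M) \int[@lebesgue_complex R]_u (f i u * (gauss1 u)%:E).
Proof.
move=> mf f0.
have mg : measurable_fun setT (@gauss1 R) by exact: measurable_gauss1.
rewrite (has_density_integral gh (F := fun v => \prod_(i < M) f i (tnth v i))).
- rewrite -integral_tuple_measure_prod.
  + apply: eq_integral => v _; rewrite gaussian_pdf_prod -prodEFin -big_split.
    by [].
  + by move=> i; apply: emeasurable_funM => //; exact/measurable_EFinP.
  + by move=> i u; rewrite mule_ge0 ?lee_fin ?gauss1_ge0.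
- apply: measurable_tuple_prod => i; exact: (measurableT_comp (mf i) (measurable_tnth i)).
- by move=> v; apply: prode_ge0.
Qed.

(** The product formula with [f] in position m and 1 elsewhere; the other factors integrate to 1. *)
Lemma integral_standard_gaussian1 m (f : R[i] -> \bar R) :
  measurable_fun setT f -> (forall u, 0 <= f u) ->
  \int[P]_t f (tnth (h t) m) = \int[@lebesgue_complex R]_u (f u * (gauss1 u)%:E).
Proof.
move=> mf f0.
pose k (i : 'I_M) u := if i == m then f u else 1.
have mk i : measurable_fun setT (k i) by rewrite /k; case: (i == m).
have k0 i u : 0 <= k i u by rewrite /k; case: (i == m).
have := integral_standard_gaussian mk k0.
rewrite [RHS](bigD1 m)//= {2}/k eqxx big1 ?mule1 => [<-|i /negPf im].
  apply: eq_integral => t _; rewrite (bigD1 m)//= {1}/k eqxx big1 ?mule1// => i.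
  by rewrite /k => /negPf ->.
by under eq_integral do rewrite /k im mul1e; exact: integral_gauss1.
Qed.

(** The fading model posits [h] as one vector, while the argument needs a family. The density
    factors over the coordinates and so does the indicator of a box. *)
Lemma standard_gaussian_independent :
  independent_family P (fun i t => tnth (h t) i).
Proof.
move=> B mB.
have mh : measurable_fun setT h by [].
have mt i : measurable_fun setT (fun t => tnth (h t) i).
  exact: (measurableT_comp (measurable_tnth i) mh).
have E (A : set T) : measurable A -> P A = \int[P]_t (\1_A t)%:E.
  by move=> mA; rewrite integral_indic ?setIT.
have mf i : measurable_fun setT (fun u : R[i] => (\1_(B i) u)%:E : \bar R).
  by apply/measurable_EFinP; exact: measurable_indic.
have f0 i u : 0 <= (\1_(B i) u)%:E :> \bar R by rewrite lee_fin.
rewrite E; last first.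
  apply: measurable_preimageT; last exact: measurable_box.
  exact: measurable_tuple_of_family.
rewrite (_ : (fun t => _) = fun t =>
    \prod_(i < M) (\1_(B i) (tnth (h t) i))%:E); last first.
  apply/funext => t; rewrite prodEFin; congr EFin.
  rewrite indicE; case: (boolP (t \in _)) => tB.
    rewrite big1// => i _; rewrite indicE mem_set//.
    by have := set_mem tB => /(_ i); rewrite tnth_mktuple.
  apply/esym/eqP/prodf_eq0.
  have /existsNP[i iB] : ~ (forall i, B i (tnth (h t) i)).
    move=> hB; move/negP : tB; apply; apply/mem_set => i.
    by rewrite tnth_mktuple.
  by exists i => //; rewrite indicE memNset.
rewrite (integral_standard_gaussian mf f0); apply: eq_bigr => i _.
rewrite -(integral_standard_gaussian1 i (mf i) (f0 i)) E//.
exact: measurable_preimageT.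
Qed.

End gaussian_family.

(** Each [b l] is at most the sum of the series [b], so a multiple of [a] dominates. *)
Lemma cvg_series_mul (R : realType) (a b : R^nat) :
  (forall l, 0 <= a l) -> (forall l, 0 <= b l) ->
  cvgn (series a) -> cvgn (series b) -> cvgn (series (fun l => a l * b l)).
Proof.
move=> a0 b0 ca cb.
apply: (@series_le_cvg _ _ (fun l => limn (series b) * a l)).
- by move=> l; rewrite mulr_ge0.
- move=> l; rewrite mulr_ge0//; apply: limr_ge => //.
  by apply: nearW => n; exact: sumr_ge0.
- move=> l; rewrite mulrC ler_wpM2r//.
  apply: le_trans (nondecreasing_cvgn_le _ cb l.+1); last exact: nondecreasing_series.
  by rewrite /series/= big_nat_recr//= lerDr sumr_ge0.
- by apply/cvg_ex; eexists; exact: cvg_seriesZ.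
Qed.

Lemma cvg_series_norm_coef (R : realType) (alpha c : R^nat) :
  (forall l, `|alpha l| <= 1) -> (forall l, 0 <= c l) -> cvgn (series c) ->
  cvgn (series (fun l => `|alpha l * c l|)).
Proof.
move=> a1 c0; apply: series_le_cvg => // l.
by rewrite normrM (ger0_norm (c0 l)) ler_piMl.
Qed.

(** * The density at one antenna *)

Section antennas.
Context d (T : measurableType d) (R : realType) (P : probability T R).
Variables (rho : R) (alpha : nat -> R) (phi : {RV P >-> R}).
Hypotheses (rho0 : 0 < rho) (pn : phase_noise alpha phi).
Implicit Types s x y : R[i].
Local Open Scope complex_scope.

Definition cc_antenna (g : R) s x y : R :=
  pi ^- 2 * expR (- cmod x ^+ 2 - cmod y ^+ 2 -
    (Num.sqrt rho * g) ^+ 2 * (1 + cmod s ^+ 2)) *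
  cos_series (fun l => alpha l *
    (besselI l (2 * (Num.sqrt rho * g) * cmod (s^* * y)) *
     besselI l (2 * (Num.sqrt rho * g) * cmod x)))
    (carg y - carg x - carg s).

Definition fc_antenna s x y : R :=
  let D := rho + rho * cmod s ^+ 2 + 1 in
  expR (- ((1 + rho * cmod s ^+ 2) / D) * cmod x ^+ 2
      - (1 + rho) / D * cmod y ^+ 2) / (pi ^+ 2 * D) *
  cos_series (fun l => alpha l *
    besselI l (2 * rho * cmod (s^* * x^* * y) / D))
    (carg y - carg x - carg s).

Lemma cvg_series_besselIM (u v : R) : 0 <= u -> 0 <= v ->
  cvgn (series (fun l => besselI l u * besselI l v)).
Proof.
move=> u0 v0; apply: cvg_series_mul; try exact: cvg_series_besselI;
by move=> l; exact: besselI_ge0.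
Qed.

Lemma cc_antennaE (g : R) (theta : {RV P >-> R}) s x y : 0 < g ->
  uniform_phase theta ->
  (cc_antenna g s x y)%:E = (\int[P]_t' \int[P]_t
    (gauss1 (x - (Num.sqrt rho * g)%:C * cexpi (theta t)) *
     gauss1 (y - (Num.sqrt rho * g)%:C * cexpi (theta t + phi t') * s))%:E)%E.
Proof.
move=> g0 ut; set a := Num.sqrt rho * g.
have a0 : 0 <= a by rewrite mulr_ge0 ?sqrtr_ge0 ?(ltW g0).
set K := pi ^- 2 * expR (- cmod x ^+ 2 - cmod y ^+ 2 - a ^+ 2 * (1 + cmod s ^+ 2)).
set u := 2 * a * cmod (s^* * y); set v := 2 * a * cmod x.
have u0 : 0 <= u := mulr_ge0 (mulr_ge0 (ler0n _ 2) a0) (cmod_ge0 _).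
have v0 : 0 <= v := mulr_ge0 (mulr_ge0 (ler0n _ 2) a0) (cmod_ge0 _).
set zeta := carg y - carg x - carg s.
pose c l := besselI l u * besselI l v.
have c0 l : 0 <= c l by rewrite mulr_ge0 ?besselI_ge0.
have cc : cvgn (series (fun l => `|c l|)).
  by under eq_fun do rewrite ger0_norm//; exact: cvg_series_besselIM.
have mth : measurable_fun setT theta by [].
have mphi : measurable_fun setT phi by [].
(* The form reached after averaging over [theta], where the phase noise occurs only through phi -
   zeta. *)
transitivity (\int[P]_t' (K * cos_series c (phi t' - zeta))%:E)%E.
  rewrite integral_bounded_measurable; last first.
    apply: bounded_measurableM; first exact: bounded_measurable_cst.
    by apply: bounded_measurable_cos_series => //; exact: measurable_funB.
  rewrite RintegralZl//; last first.
    apply: bounded_measurable_integrable.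
    by apply: bounded_measurable_cos_series => //; exact: measurable_funB.
  by rewrite (expectation_cos_series_phase_noise pn).
apply: eq_integral => t' _.
under eq_integral do rewrite gauss1_constant_channel -/K -/u -/v mulrC.
have bb : bounded_measurable (fun t =>
    expR (v * cos (theta t - carg x)) *
    expR (u * cos (theta t + (phi t' + carg s - carg y)))).
  apply: bounded_measurableM; apply: bounded_measurable_expcos.
    exact: measurable_funB.
  exact: measurable_funD.
under eq_integral do rewrite mulrC.
rewrite integral_bounded_measurable; last first.
  by apply: bounded_measurableM => //; exact: bounded_measurable_cst.
rewrite RintegralZl//; last exact: bounded_measurable_integrable.
congr (_ * _)%:E.
(* The exponential in [y] goes first, so that the difference of the two shifts is phi + arg s - arg
   y + arg x = phi - zeta. *)
under eq_Rintegral do rewrite mulrC.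
rewrite (expectation_besselI_uniform _ _ u0 v0 ut); congr cos_series.
by rewrite /zeta; ring.
Qed.

Lemma fc_antennaE M (h : {RV P >-> M.-tuple R[i]}) m s x y :
  standard_gaussian h ->
  (fc_antenna s x y)%:E = (\int[P]_t' \int[P]_t
    (gauss1 (x - (Num.sqrt rho)%:C * tnth (h t) m) *
     gauss1 (y - (Num.sqrt rho)%:C * cexpi (phi t') * tnth (h t) m * s))%:E)%E.
Proof.
move=> gh; rewrite /fc_antenna.
set D := rho + rho * cmod s ^+ 2 + 1.
set K := expR _ / _; set kappa := 2 * rho * _ / D.
set zeta := carg y - carg x - carg s.
have D0 : 0 < D.
  have : 0 <= rho * cmod s ^+ 2 by rewrite mulr_ge0 ?sqr_ge0 ?ltW.
  by move=> c0; rewrite /D ltr_wpDl// addr_ge0// ltW.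
have kappa0 : 0 <= kappa.
  by rewrite divr_ge0 ?(ltW D0)// !mulr_ge0 ?cmod_ge0// ltW.
have mphi : measurable_fun setT phi by [].
have be : bounded_measurable (fun t => expR (kappa * cos (phi t - zeta))).
  by apply: bounded_measurable_expcos; exact: measurable_funB.
transitivity (\int[P]_t' (K * expR (kappa * cos (phi t' - zeta)))%:E)%E.
  rewrite integral_bounded_measurable; last first.
    by apply: bounded_measurableM => //; exact: bounded_measurable_cst.
  rewrite RintegralZl//; last exact: bounded_measurable_integrable.
  by rewrite (expectation_expcos_phase_noise pn).
apply: eq_integral => t' _; set t := phi t'.
have mF : measurable_fun setT (fun u : R[i] =>
    (gauss1 (x - (Num.sqrt rho)%:C * u) *
     gauss1 (y - (Num.sqrt rho)%:C * cexpi t * u * s))%:E).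
  have mu : measurable_fun setT (fun u : R[i] => u) by exact: measurable_id.
  apply/measurable_EFinP; apply: measurable_funM; apply: measurable_gauss1;
    apply: measurable_complexD => //; apply: measurable_complexN.
    exact: measurable_complexM.
  by apply: measurable_complexM => //; exact: measurable_complexM.
rewrite (integral_standard_gaussian1 gh m mF); last first.
  by move=> u; rewrite lee_fin mulr_ge0 ?gauss1_ge0.
under eq_integral do rewrite -EFinM mulrC gauss1_fading_channel// -/D.
(* The integral over [h] is pi / D wherever the square is centred, so the phase in the centre
   disappears, and pi^-3 becomes 1 / (pi^2 D). *)
rewrite integral_complex_gaussian//; last first.
  by rewrite !mulr_ge0 ?expR_ge0// invr_ge0 exprn_ge0// pi_ge0.
congr EFin; rewrite -/kappa -/zeta /K.
have pi0 : pi != 0 :> R by rewrite gt_eqF// pi_gt0.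
have D0' : D != 0 by rewrite gt_eqF.
by move: pi0; generalize (@pi R) => w w0; field; rewrite w0 D0'.
Qed.

End antennas.

(** * Product formulas on boxes for the two models *)

Section models.
Context d (T : measurableType d) (R : realType) (P : probability T R).
Variables (M : nat) (rho : R) (alpha : 'I_M -> nat -> R).
Variable S : {RV P >-> R[i]}.

Lemma sigma_generated_preimage d' (U : measurableType d') (X : T -> U) A :
  measurable A -> sigma_generated X (X @^-1` A).
Proof. by move=> mA; exists A => //; rewrite setTI. Qed.

Lemma mutually_independentT (I : finType) (F : I -> set (set T)) (E : I -> set T) :
  mutually_independent P F -> (forall i, F i (E i)) ->
  P [set t | forall i, E i t] = (\prod_i P (E i))%E.
Proof.
move=> ind FE; have := ind (finset.setTfor I) E (fun i _ => FE i).
rewrite (eq_bigl xpredT); last by move=> i /=; rewrite finset.in_setT.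
move=> <-; congr (P _); apply/seteqP; split => t /= h i; first by [].
by apply: h; rewrite /= finset.in_setT.
Qed.

Lemma cc_ns_box_independent (g : 'I_M -> R) (theta phi : 'I_M -> {RV P >-> R})
    (w z : {RV P >-> M.-tuple R[i]}) : cc_ns_model alpha g theta phi w z S ->
  forall A B C1 C2 C3,
  (forall i, measurable (A i)) -> (forall i, measurable (B i)) ->
  measurable C1 -> measurable C2 -> measurable C3 ->
  P (tuple_of_family theta @^-1` box A `&` (tuple_of_family phi @^-1` box B `&`
    (w @^-1` C1 `&` (z @^-1` C2 `&` S @^-1` C3)))) =
  (\prod_(i < M) P (theta i @^-1` A i) * (\prod_(i < M) P (phi i @^-1` B i) *
    (P (w @^-1` C1) * (P (z @^-1` C2) * P (S @^-1` C3)))))%E.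
Proof.
move=> cc A B C1 C2 C3 mA mB m1 m2 m3.
pose E (i : 'I_M + 'I_M + 'I_3) : set T := match i with
  | inl (inl m) => theta m @^-1` A m
  | inl (inr m) => phi m @^-1` B m
  | inr k => tnth [tuple w @^-1` C1; z @^-1` C2; S @^-1` C3] k end.
have := mutually_independentT (E := E) (cc_indep cc).
rewrite !big_sumType/= !big_ord_recl big_ord0 mule1 !muleA => <-; last first.
  case=> [[m|m]|[[|[|[|//]]] k3]] /=; rewrite ?(tnth_nth set0)//=;
    exact: sigma_generated_preimage.
congr (P _); apply/seteqP; split => t /=.
  move=> [At [Bt [wt [zt St]]]] [[m|m]|[[|[|[|//]]] k3]] /=.
  - by have := At m; rewrite tnth_mktuple.
  - by have := Bt m; rewrite tnth_mktuple.
  - by rewrite (tnth_nth set0).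
  - by rewrite (tnth_nth set0).
  - by rewrite (tnth_nth set0).
move=> Et; split; first by move=> m; have := Et (inl (inl m)); rewrite tnth_mktuple.
split; first by move=> m; have := Et (inl (inr m)); rewrite tnth_mktuple.
split; first by have := Et (inr (@Ordinal 3 0 isT)); rewrite /= (tnth_nth set0).
split; first by have := Et (inr (@Ordinal 3 1 isT)); rewrite /= (tnth_nth set0).
by have := Et (inr (@Ordinal 3 2 isT)); rewrite /= (tnth_nth set0).
Qed.

(** A box of coordinates is an event of the single vector [h], to which the independence in the
    model applies; its probability then splits by [standard_gaussian_independent]. *)
Lemma fc_ns_box_independent (phi : 'I_M -> {RV P >-> R})
    (h w z : {RV P >-> M.-tuple R[i]}) : fc_ns_model alpha phi h w z S ->
  let H i t := tnth (h t) i in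
  forall A B C1 C2 C3,
  (forall i, measurable (A i)) -> (forall i, measurable (B i)) ->
  measurable C1 -> measurable C2 -> measurable C3 ->
  P (tuple_of_family H @^-1` box A `&` (tuple_of_family phi @^-1` box B `&`
    (w @^-1` C1 `&` (z @^-1` C2 `&` S @^-1` C3)))) =
  (\prod_(i < M) P (H i @^-1` A i) * (\prod_(i < M) P (phi i @^-1` B i) *
    (P (w @^-1` C1) * (P (z @^-1` C2) * P (S @^-1` C3)))))%E.
Proof.
move=> fc H A B C1 C2 C3 mA mB m1 m2 m3.
rewrite -(standard_gaussian_independent (fc_h fc) mA).
have hE : tuple_of_family H @^-1` box A = h @^-1` box A.
  by apply/seteqP; split => t /= ht i; have := ht i; rewrite tnth_mktuple.
rewrite -/H hE.
pose E (i : 'I_M + 'I_4) : set T := match i with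
  | inl m => phi m @^-1` B m
  | inr k => tnth [tuple h @^-1` box A; w @^-1` C1; z @^-1` C2; S @^-1` C3] k end.
have := mutually_independentT (E := E) (fc_indep fc).
rewrite !big_sumType/= !big_ord_recl big_ord0 mule1 => EE.
rewrite muleCA -EE; last first.
  case=> [m|[[|[|[|[|//]]]] k3]] /=; rewrite ?(tnth_nth set0)//=;
    apply: sigma_generated_preimage => //; exact: measurable_box.
congr (P _); apply/seteqP; split => t /=.
  move=> [At [Bt [wt [zt St]]]] [m|[[|[|[|[|//]]]] k3]] /=.
  - by have := Bt m; rewrite tnth_mktuple.
  - by rewrite (tnth_nth set0).
  - by rewrite (tnth_nth set0).
  - by rewrite (tnth_nth set0).
  - by rewrite (tnth_nth set0).
move=> Et.
split; first by have := Et (inr (@Ordinal 4 0 isT)); rewrite /= (tnth_nth set0).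
split; first by move=> m; have := Et (inl m); rewrite tnth_mktuple.
split; first by have := Et (inr (@Ordinal 4 1 isT)); rewrite /= (tnth_nth set0).
split; first by have := Et (inr (@Ordinal 4 2 isT)); rewrite /= (tnth_nth set0).
by have := Et (inr (@Ordinal 4 3 isT)); rewrite /= (tnth_nth set0).
Qed.

End models.

Section densities.
Variables (R : realType) (M : nat) (rho : R) (alpha : 'I_M -> nat -> R).
Hypothesis rho0 : 0 < rho.
Implicit Types (s : R[i]) (xy : M.-tuple R[i] * M.-tuple R[i]).

Lemma cc_ns_density_prod (g : 'I_M -> R) s xy :
  ns_density (cc_ns_A rho g) (cc_ns_beta rho alpha g) s xy =
  \prod_(m < M) cc_antenna rho (alpha m) (g m) s (tnth xy.1 m) (tnth xy.2 m).
Proof.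
rewrite /ns_density /cc_antenna [RHS]big_split/=; congr (_ * _); last first.
  apply: eq_bigr => m _; rewrite /cc_ns_beta /zeta; congr cos_series.
  by apply/funext => l; rewrite -mulrA !mulrA.
rewrite big_split/= prodr_const card_ord -expR_sum /cc_ns_A mulrC exprVn exprM.
congr (_ * expR _).
rewrite !sumrB sumrN -/(norm2 _) -/(norm2 _); congr (_ - _ - _).
rewrite mulr_sumr; apply: eq_bigr => m _.
by rewrite exprMn sqr_sqrtr ?ltW//; ring.
Qed.

Lemma fc_ns_density_prod s xy :
  ns_density (@fc_ns_A R M rho) (fc_ns_beta rho alpha) s xy =
  \prod_(m < M) fc_antenna rho (alpha m) s (tnth xy.1 m) (tnth xy.2 m).
Proof.
rewrite /ns_density /fc_antenna [RHS]big_split/=; congr (_ * _).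
rewrite big_split/= prodr_const card_ord -expR_sum /fc_ns_A exprVn.
congr (expR _ * _).
by rewrite sumrB -!mulr_sumr.
Qed.

End densities.

Theorem proposition1 (R : realType) (M : nat) (hM : (1 <= M)%N)
    (rho : R) (hrho : 0 < rho) (alpha : 'I_M -> nat -> R)
    (d : measure_display) (T : measurableType d) (P : probability T R)
    (S : {RV P >-> R[i]}) :
  (forall (g : 'I_M -> R) (theta phi : 'I_M -> {RV P >-> R})
      (w z : {RV P >-> M.-tuple R[i]}),
    cc_ns_model alpha g theta phi w z S ->
    let lambda := (lebesgue_cvec R M \x lebesgue_cvec R M)%E in
    let p := ns_density (cc_ns_A rho g) (cc_ns_beta rho alpha g) in
    [/\ (forall s x y m,
          cvgn (cos_psum (cc_ns_beta rho alpha g s x y m) (zeta s x y m))),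
        (forall s : R[i],
          has_density P lambda
            (cc_ns_output rho g theta phi w z (fun=> s)) (p s)) &
        has_conditional_density lambda S
          (cc_ns_output rho g theta phi w z S) p])
  /\
  (forall (phi : 'I_M -> {RV P >-> R}) (h w z : {RV P >-> M.-tuple R[i]}),
    fc_ns_model alpha phi h w z S ->
    let lambda := (lebesgue_cvec R M \x lebesgue_cvec R M)%E in
    let p := ns_density (@fc_ns_A R M rho) (fc_ns_beta rho alpha) in
    [/\ (forall s x y m,
          cvgn (cos_psum (fc_ns_beta rho alpha s x y m) (zeta s x y m))),
        (forall s : R[i],
          has_density P lambda
            (fc_ns_output rho phi h w z (fun=> s)) (p s)) &
        has_conditional_density lambda S
          (fc_ns_output rho phi h w z S) p]).
Proof.
split=> [g theta phi w z cc lambda p|phi h w z fc lambda p].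
- have mcos m (h : R -> R) : measurable_fun setT h ->
      measurable_fun setT (fun v => (Num.sqrt rho * g m)%:C%C * cexpi (h v)).
    move=> mh; apply: measurable_complexM; last exact: measurable_cexpi.
    exact: measurable_cst.
  have mb m : measurable_fun setT (fun u : R[i] * (R * R) =>
      (Num.sqrt rho * g m)%:C%C * cexpi (u.2.1 + u.2.2) * u.1).
    apply: measurable_complexM => //; apply: measurable_complexM => //.
    apply: measurable_cexpi; apply: measurable_funD.
      exact: (measurableT_comp measurable_fst measurable_snd).
    exact: (measurableT_comp measurable_snd measurable_snd).
  have qE m s x y : (cc_antenna rho (alpha m) (g m) s x y)%:E =
      (\int[P]_t' \int[P]_t
      (gauss1 (x - (Num.sqrt rho * g m)%:C%C * cexpi (theta m t)) *
       gauss1 (y - (Num.sqrt rho * g m)%:C%C *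
         cexpi (theta m t + phi m t') * s))%:E)%E.
    apply: cc_antennaE; first exact: (cc_phi cc).
      exact: (cc_gain cc).
    exact: (cc_theta cc).
  have pE : p = fun s xy => \prod_(m < M)
      cc_antenna rho (alpha m) (g m) s (tnth xy.1 m) (tnth xy.2 m).
    by apply/funext => s; apply/funext => xy; exact: cc_ns_density_prod.
  have ind := cc_ns_box_independent cc.
  have mth m : measurable_fun setT (theta m) by [].
  have mph m : measurable_fun setT (phi m) by [].
  (* In the constant channel the first hidden family is [theta], the second [phi]. *)
  pose a m v := (Num.sqrt rho * g m)%:C%C * cexpi v.
  pose b m s (v : R * R) := (Num.sqrt rho * g m)%:C%C * cexpi (v.1 + v.2) * s.
  have ma m : measurable_fun setT (a m) := mcos m _ (@measurable_id _ _ _).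
  split.
  (* Convergence is absolute: the Bessel products are summable and the coefficients [alpha] are
     bounded by 1. *)
  + move=> s x y m; apply: cvg_cos_psum; rewrite /cc_ns_beta.
    under eq_fun do rewrite -mulrA.
    have k0 (c : R[i]) : 0 <= 2 * Num.sqrt rho * g m * cmod c.
      by rewrite !mulr_ge0 ?sqrtr_ge0 ?cmod_ge0// ltW// (cc_gain cc).
    apply: cvg_series_norm_coef.
    * exact: (norm_phase_noise_coef_le1 (cc_phi cc m)).
    * by move=> l; rewrite mulr_ge0 ?besselI_ge0.
    * exact: cvg_series_besselIM.
  + move=> s; rewrite pE.
    exact: (nonsynchronous_density (a := a) (b := b) mth mph ma mb
      (cc_w cc) (cc_z cc) ind qE s).
  + rewrite pE.
    exact: (nonsynchronous_conditional_density (a := a) (b := b) mth mph ma mb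
      (cc_w cc) (cc_z cc) ind qE).
- have ma (m : 'I_M) : measurable_fun setT (fun v : R[i] => (Num.sqrt rho)%:C%C * v).
    by apply: measurable_complexM => //; exact: measurable_cst.
  have mb (m : 'I_M) : measurable_fun setT (fun u : R[i] * (R[i] * R) =>
      (Num.sqrt rho)%:C%C * cexpi u.2.2 * u.2.1 * u.1).
    apply: measurable_complexM => //; apply: measurable_complexM; last first.
      exact: (measurableT_comp measurable_fst measurable_snd).
    apply: measurable_complexM => //; apply: measurable_cexpi.
    exact: (measurableT_comp measurable_snd measurable_snd).
  have qE m s x y : (fc_antenna rho (alpha m) s x y)%:E =
      (\int[P]_t' \int[P]_t
      (gauss1 (x - (Num.sqrt rho)%:C%C * tnth (h t) m) *
       gauss1 (y - (Num.sqrt rho)%:C%C * cexpi (phi m t') * tnth (h t) m * s))%:E)%E.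
    by apply: fc_antennaE => //; [exact: (fc_phi fc)|exact: (fc_h fc)].
  have pE : p = fun s xy => \prod_(m < M)
      fc_antenna rho (alpha m) s (tnth xy.1 m) (tnth xy.2 m).
    by apply/funext => s; apply/funext => xy; exact: fc_ns_density_prod.
  have ind := fc_ns_box_independent fc.
  have mh m : measurable_fun setT (fun t => tnth (h t) m).
    by apply: (measurableT_comp (measurable_tnth m)).
  have mph m : measurable_fun setT (phi m) by [].
  (* In the fading channel the coordinates of [h] take the place of [theta]. *)
  pose a (m : 'I_M) (v : R[i]) := (Num.sqrt rho)%:C%C * v.
  pose b (m : 'I_M) s (v : R[i] * R) := (Num.sqrt rho)%:C%C * cexpi v.2 * v.1 * s.
  split.
  + move=> s x y m; apply: cvg_cos_psum; rewrite /fc_ns_beta.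
    have k0 : 0 <= 2 * rho * cmod (s^* * (tnth x m)^* * tnth y m)%C /
        (rho + rho * cmod s ^+ 2 + 1).
      have r0 := ltW hrho.
      by rewrite divr_ge0 ?addr_ge0 ?mulr_ge0 ?cmod_ge0 ?sqr_ge0.
    apply: cvg_series_norm_coef.
    * exact: (norm_phase_noise_coef_le1 (fc_phi fc m)).
    * by move=> l; exact: besselI_ge0.
    * exact: cvg_series_besselI.
  + move=> s; rewrite pE.
    exact: (nonsynchronous_density (a := a) (b := b) mh mph ma mb
      (fc_w fc) (fc_z fc) ind qE s).
  + rewrite pE.
    exact: (nonsynchronous_conditional_density (a := a) (b := b) mh mph ma mb
      (fc_w fc) (fc_z fc) ind qE).
Qed.
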